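(* Let $G$ be a word-hyperbolic group. Then there exists a constant $M$ such that for any two elements $a,b\in G$ of infinite order, either the subgroup $\langle a,b\rangle$ is elementary, or else for any integers $n,m\ge M$ the subgroup $\langle a^n,b^m\rangle$ is free and quasi-convex in $G$.
   Context: A subgroup of a word-hyperbolic group is elementary if it is virtually cyclic. A subgroup $H<G$ is quasi-convex if, in the Cayley graph of $G$ for a finite generating set, there is a constant $C$ such that every geodesic joining two points of $H$ stays in the $C$-neighborhood of $H$. *)

(* Defs.v *)
(* MathComp, with the sets of mathcomp-classical for possibly infinite groups. *)
From HB Require Import structures.
From mathcomp Require Import all_boot.
From mathcomp Require Import boolp classical_sets cardinality.

Set Implicit Arguments.
Unset Strict Implicit.
Unset Printing Implicit Defensive.

Local Open Scope classical_set_scope.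
Local Open Scope group_scope.

(* Graphs are relations on a possibly infinite vertex type. A path from x is
   given by the sequence p of its vertices after x, so its length is size p. *)
Section Graph.
Variables (V : eqType) (e : rel V).

Definition path_from_to (x y : V) (p : seq V) : Prop :=
  path e x p /\ last x p = y.

Definition geodesic (x y : V) (p : seq V) : Prop :=
  path_from_to x y p /\
  forall q : seq V, path_from_to x y q -> (size p <= size q)%N.

Definition dist_le (x y : V) (n : nat) : Prop :=
  exists2 p : seq V, path_from_to x y p & (size p <= n)%N.

Definition neighborhood (A : set V) (n : nat) : set V :=
  [set x | exists2 y, A y & dist_le x y n].

(* Only one side is tested: the quantification covers all cyclic relabelings of
   the triangle. *)
Definition slim_triangles (delta : nat) : Prop :=
  forall (x y z : V) (p q r : seq V),
    geodesic x y p -> geodesic y z q -> geodesic z x r ->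
    [set` x :: p] `<=` neighborhood ([set` y :: q] `|` [set` z :: r]) delta.

End Graph.

Section Group.
Variable G : groupType.

Definition is_subgroup (H : set G) : Prop :=
  [/\ H 1, (forall x y, H x -> H y -> H (x * y)) & (forall x, H x -> H x^-1)].

Definition generated (A : set G) : set G := smallest is_subgroup A.

Definition infinite_order (x : G) : Prop :=
  forall n : nat, (0 < n)%N -> x ^+ n <> 1.

Definition left_coset (x : G) (K : set G) : set G := [set x * k | k in K].

Definition finite_index (K H : set G) : Prop :=
  finite_set [set left_coset h K | h in H].

(* Virtually cyclic. *)
Definition elementary (H : set G) : Prop :=
  exists2 c, H c & finite_index (generated [set c]) H.

(* The letter (x, true) stands for x and (x, false) for its formal inverse. *)
Definition letter_val (l : G * bool) : G := if l.2 then l.1 else l.1^-1.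

Definition word_val (w : seq (G * bool)) : G := \prod_(l <- w) letter_val l.

Definition reduced (w : seq (G * bool)) : bool :=
  sorted (fun l l' => l' != (l.1, ~~ l.2)) w.

(* The canonical map from the free group on X (the reduced words) to H is
   surjective and has trivial kernel. *)
Definition free_basis (X H : set G) : Prop :=
  generated X = H /\
  forall w : seq (G * bool),
    (forall l, l \in w -> X l.1) -> reduced w -> word_val w = 1 -> w = [::].

Definition free_subgroup (H : set G) : Prop := exists X : set G, free_basis X H.

Definition generating (S : seq G) : Prop := generated [set` S] = setT.

(* Edges join g to g * s for s or s^-1 in S. *)
Definition cayley (S : seq G) : rel G :=
  fun x y => (x^-1 * y \in S) || (y^-1 * x \in S).

Definition quasi_convex_wrt (S : seq G) (H : set G) : Prop :=
  exists C : nat, forall (x y : G) (p : seq G),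
    H x -> H y -> geodesic (cayley S) x y p ->
    [set` x :: p] `<=` neighborhood (cayley S) H C.

(* The generating set is universally quantified; in a word-hyperbolic group
   quasi-convexity does not depend on it. *)
Definition quasi_convex (H : set G) : Prop :=
  forall S : seq G, generating S -> quasi_convex_wrt S H.

End Group.

Definition word_hyperbolic (G : groupType) : Prop :=
  exists2 S : seq G, generating S &
    exists delta : nat, slim_triangles (cayley S) delta.

(* Main.v *)
(* A point x is on a quasi-axis of g when the orbit g^i x is uniformly close to a
   geodesic and its step is long compared with the hyperbolicity constant. By
   pigeonhole in a ball there is one exponent K such that a^K has a quasi-axis for
   every a of infinite order. If the axes of b^K and of a conjugate g b^K g^-1 run
   together for a long time compared with the step, another pigeonhole argument gives
   g b^p g^-1 = b^p or b^-p, so g^2 commutes with b^p; applied to powers g of a, this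
   yields commuting powers of a and b, and <a, b> is virtually cyclic because the
   centralizer of an element of infinite order is. Otherwise let the step of b^K be
   the longer one and let o be the point of its axis nearest to the axis of a^K: all
   products of B^l o and A^k B^l' o seen from o are then bounded by a multiple of this
   step, however large the overlap is compared with the step of a, while B moves o
   much further. Alternating words therefore follow local geodesics, so the subgroup
   is free and quasi-isometrically embedded, and stability of quasi-geodesics makes it
   quasi-convex for every finite generating set. *)
From Stdlib Require Import ZArith Lia.
Require Import Defs.
From mathcomp Require Import all_boot.
From mathcomp Require Import boolp classical_sets cardinality.

Local Open Scope classical_set_scope.
Local Open Scope group_scope.

(** * Integer powers and Gromov products *)

Section IntegerPowers.
Context {G : groupType}.
Implicit Types (x y : G) (i j : Z).

(** The obstacle is the uniformity of M. The step of a quasi-axis has no upper bound, so the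
    pigeonholes behind M take place in balls whose radius is a multiple of [h] alone, while lengths
    along the axes are measured in steps. Only the exponent [K] and the overlap constant [c], both
    fixed by the group, then enter M. The exponents n and m need not be multiples of [K]: since a
    commutes with a^K, its orbit follows that of a^K, and a^l displaces the base point about as much
    as the nearest power of a^K. The growth constant [L] of words does depend on a, b, n and m; it
    serves only freeness and the quasi-convexity constant, where no uniformity is asked. Gromov
    products are doubled to remain integers. *)

Definition zpow x i : G :=
  match i with
  | Z0 => 1
  | Zpos p => x ^+ Pos.to_nat p
  | Zneg p => x ^- Pos.to_nat p
  end.

Lemma zpow_nat x n : zpow x (Z.of_nat n) = x ^+ n.
Proof. by case: n => //= n; rewrite SuccNat2Pos.id_succ. Qed.

Lemma zpowN x i : zpow x (- i) = (zpow x i)^-1.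
Proof. by case: i => /=; rewrite ?invg1 // => p; rewrite invgK. Qed.

Lemma Z_natP i : (exists n, i = Z.of_nat n) \/ (exists n, i = (- Z.of_nat n)%Z).
Proof.
have [?|?] := Z.le_ge_cases 0 i; [left; exists (Z.to_nat i)|right; exists (Z.to_nat (-i))]; lia.
Qed.

Lemma zpowS x i : zpow x (i + 1) = zpow x i * x.
Proof.
have [[n ->]|[[|n] ->]] := Z_natP i.
- have -> : (Z.of_nat n + 1 = Z.of_nat n.+1)%Z by lia.
  by rewrite !zpow_nat expgSr.
- by rewrite /= mul1g.
- have -> : (- Z.of_nat n.+1 + 1 = - Z.of_nat n)%Z by lia.
  by rewrite !zpowN !zpow_nat expgS invgM mulgVK.
Qed.

Lemma zpow_pred x i : zpow x (i - 1) = zpow x i * x^-1.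
Proof.
have -> : zpow x i = zpow x (i - 1) * x by rewrite -zpowS; congr zpow; lia.
by rewrite mulgK.
Qed.

Lemma zpowD x i j : zpow x (i + j) = zpow x i * zpow x j.
Proof.
have [[n ->]|[n ->]] := Z_natP j; elim: n => [|n IH].
- by rewrite Z.add_0_r mulg1.
- have -> : (i + Z.of_nat n.+1 = (i + Z.of_nat n) + 1)%Z by lia.
  have -> : (Z.of_nat n.+1 = Z.of_nat n + 1)%Z by lia.
  by rewrite !zpowS IH mulgA.
- by rewrite Z.add_0_r mulg1.
- have -> : (i + - Z.of_nat n.+1 = (i + - Z.of_nat n) - 1)%Z by lia.
  have -> : (- Z.of_nat n.+1 = - Z.of_nat n - 1)%Z by lia.
  by rewrite !zpow_pred IH mulgA.
Qed.

Lemma zpow1 x : zpow x 1 = x.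
Proof. by rewrite /= Pos2Nat.inj_1 expg1. Qed.

Lemma zpowM x i j : zpow x (i * j) = zpow (zpow x i) j.
Proof.
have [[n ->]|[n ->]] := Z_natP j; elim: n => [|n IH].
- by rewrite Z.mul_0_r.
- have -> : (i * Z.of_nat n.+1 = i * Z.of_nat n + i)%Z by lia.
  have -> : (Z.of_nat n.+1 = Z.of_nat n + 1)%Z by lia.
  by rewrite zpowD IH zpowS.
- by rewrite Z.mul_0_r.
- have -> : (i * - Z.of_nat n.+1 = i * - Z.of_nat n + - i)%Z by lia.
  have -> : (- Z.of_nat n.+1 = - Z.of_nat n - 1)%Z by lia.
  by rewrite zpowD IH zpow_pred -zpowN.
Qed.

Lemma zpowV x i : zpow x^-1 i = zpow x (- i).
Proof.
rewrite -{1}(zpow1 x) -zpowN -zpowM; congr zpow; lia.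
Qed.

Lemma zpow_commute x y i : commute x y -> commute (zpow x i) y.
Proof.
move=> cxy; have [[n ->]|[n ->]] := Z_natP i; rewrite ?zpowN zpow_nat.
- exact/commute_sym/commuteX/commute_sym.
- exact/commute_sym/commuteV/commuteX/commute_sym.
Qed.

Lemma zpow_commute2 x y i j : commute x y -> commute (zpow x i) (zpow y j).
Proof.
by move=> cxy; apply: zpow_commute; apply/commute_sym/zpow_commute/commute_sym.
Qed.

Lemma zpow_conj x y i : zpow (y * x * y^-1) i = y * zpow x i * y^-1.
Proof.
have [[n ->]|[n ->]] := Z_natP i; rewrite ?zpowN !zpow_nat.
- elim: n => [|n IH]; first by rewrite !expg0 mulg1 mulgV.
  by rewrite !expgS IH !mulgA mulgVK.
- suff -> : (y * x * y^-1) ^+ n = y * x ^+ n * y^-1 by rewrite !invgM invgK mulgA.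
  elim: n => [|n IH]; first by rewrite !expg0 mulg1 mulgV.
  by rewrite !expgS IH !mulgA mulgVK.
Qed.

Lemma infinite_order_zpow x i : infinite_order x -> zpow x i = 1 -> i = 0%Z.
Proof.
move=> ox; have [[[|n] ->]|[[|n] ->]] // := Z_natP i; rewrite ?zpowN zpow_nat.
- by move/(ox n.+1 isT).
- by move=> /eqP; rewrite invg_eq1 => /eqP/(ox n.+1 isT).
Qed.

Lemma zpow_inj x i j : infinite_order x -> zpow x i = zpow x j -> i = j.
Proof.
move=> ox e; have : zpow x (i - j) = 1.
  by rewrite -Z.add_opp_r zpowD zpowN e mulgV.
move/(infinite_order_zpow _ _ ox); lia.
Qed.

End IntegerPowers.

(* Distances take their values in Z, so that no subtraction is truncated. *)
Record hyperbolic_metric {G : groupType} (d : G -> G -> Z) (h : Z) : Prop :=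
  HyperbolicMetric {
    dist_ge0 : forall x y, (0 <= d x y)%Z;
    dist_eq0 : forall x y, d x y = 0%Z -> x = y;
    distxx : forall x, d x x = 0%Z;
    distC : forall x y, d x y = d y x;
    dist_triangle : forall x y z, (d x z <= d x y + d y z)%Z;
    distM : forall g x y, d (g * x) (g * y) = d x y;
    dist_between : forall x y i, (0 <= i <= d x y)%Z ->
      exists z, d x z = i /\ d z y = (d x y - i)%Z;
    finite_balls : forall r, exists s : seq G, forall g, (d 1%g g <= r)%Z -> g \in s;
    four_point : forall x y z w,
      (d x z + d y w <= Z.max (d x y + d z w) (d x w + d y z) + h)%Z;
    hyp_gt0 : (0 < h)%Z
  }.

Arguments dist_ge0 {G d h}. Arguments dist_eq0 {G d h}. Arguments distxx {G d h}.
Arguments distC {G d h}. Arguments dist_triangle {G d h}. Arguments distM {G d h}.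
Arguments dist_between {G d h}. Arguments finite_balls {G d h}.
Arguments four_point {G d h}. Arguments hyp_gt0 {G d h}.

(* Twice the Gromov product of x and y based at z. *)
Definition gromov {G : groupType} (d : G -> G -> Z) (x y z : G) : Z :=
  (d x z + d y z - d x y)%Z.

(** * Calculus of doubled Gromov products *)

Section HyperbolicGeometry.
Context {G : groupType} {d : G -> G -> Z} {h : Z}.
Hypothesis hd : hyperbolic_metric d h.
Local Open Scope Z_scope.
Local Notation gp := (gromov d).
Implicit Types (x y z o : G).

Lemma gpC x y z : gp x y z = gp y x z.
Proof. rewrite /gromov (distC hd x y); lia. Qed.

Lemma gpM g x y z : gp (g * x)%g (g * y)%g (g * z)%g = gp x y z.
Proof. by rewrite /gromov !(distM hd). Qed.

Lemma gp_le x y z : gp x y z <= 2 * d x z.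
Proof.
by rewrite /gromov; have := dist_triangle hd y x z; rewrite (distC hd y x); lia.
Qed.

Lemma gp_compl x y z : gp x y z + gp z y x = 2 * d x z.
Proof. rewrite /gromov (distC hd z x) (distC hd z y) (distC hd y x); lia. Qed.

Lemma gp_four x y z w : Z.min (gp x y w) (gp y z w) <= gp x z w + h.
Proof.
rewrite /gromov; have := four_point hd x y z w; rewrite (distC hd z w); lia.
Qed.

(** An endpoint may be exchanged for one whose direction from [z] agrees with it long enough, at the
    price of one [h]. Most chains of estimates below consist of such exchanges. *)
Lemma gp_move x x' y z c :
  gp x y z <= c -> gp x x' z > c + h -> gp x' y z <= c + h.
Proof. by move=> l1 l2; have := gp_four x x' y z; lia. Qed.

Lemma gp_move_r x y y' z c :
  gp x y z <= c -> gp y y' z > c + h -> gp x y' z <= c + h.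
Proof. by rewrite gpC => l1 l2; rewrite gpC; apply: gp_move l1 l2. Qed.

Lemma gp_lip x x' y z : gp x' y z <= gp x y z + 2 * d x x'.
Proof.
rewrite /gromov; have := dist_triangle hd x' x z; have := dist_triangle hd x x' y.
rewrite (distC hd x' x); lia.
Qed.

Lemma gp_lip_r x y y' z : gp x y' z <= gp x y z + 2 * d y y'.
Proof. by rewrite (gpC x y') (gpC x y); apply: gp_lip. Qed.

Lemma gp_near x x' z : gp x x' z >= 2 * d x z - 2 * d x x'.
Proof. rewrite /gromov; have := dist_triangle hd x x' z; lia. Qed.

End HyperbolicGeometry.

(** * Quasi-axes *)

Section QuasiAxes.
Context {G : groupType} {d : G -> G -> Z} {h : Z}.
Hypothesis hd : hyperbolic_metric d h.
Local Open Scope Z_scope.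
Local Notation gp := (gromov d).
Implicit Types (x y z o g : G).

Definition orb g x i : G := (zpow g i * x)%g.

Lemma orb0 g x : orb g x 0 = x.
Proof. exact: mul1g. Qed.

Lemma orb1 g x : orb g x 1 = (g * x)%g.
Proof. by rewrite /orb zpow1. Qed.

Lemma orbD g x i j : orb g x (i + j) = (zpow g i * orb g x j)%g.
Proof. by rewrite /orb zpowD mulgA. Qed.

Lemma orb_orb g x i j : orb g (orb g x i) j = orb g x (j + i).
Proof. by rewrite orbD. Qed.

Lemma orbV g x i : orb g^-1 x i = orb g x (- i).
Proof. by rewrite /orb zpowV. Qed.

Lemma orb_zpow g x i j : orb (zpow g i) x j = orb g x (i * j).
Proof. by rewrite /orb zpowM. Qed.

Lemma dist_orb g x a b a' b' : a - a' = b - b' ->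
  d (orb g x a) (orb g x b) = d (orb g x a') (orb g x b').
Proof.
move=> e; have [s [-> ->]] : exists s, a = s + a' /\ b = s + b'.
  by exists (a - a'); lia.
by rewrite !orbD (distM hd).
Qed.

Arguments dist_orb g x {a b} a' b' _.

Lemma gp_orb g x a b c a' b' c' : a - a' = b - b' -> b - b' = c - c' ->
  gp (orb g x a) (orb g x b) (orb g x c) = gp (orb g x a') (orb g x b') (orb g x c').
Proof.
move=> e1 e2; rewrite /gromov (dist_orb g x (a') (c')); last lia.
by rewrite (dist_orb g x b' c' e2) (dist_orb g x a' b' e1).
Qed.

Arguments gp_orb g x {a b c} a' b' c' _ _.

(* The bound 12 h is what a bound 10 h at consecutive points of the orbit propagates
   to (local_axis); 1000 stands for any large number. *)
Definition qaxis g x :=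
  1000 * h <= d x (g * x)%g /\
  forall i k, 0 <= i -> 0 <= k -> gp (orb g x (- i)) (orb g x k) x <= 12 * h.

Lemma gp_base_l x y : gp x y x = 0.
Proof. rewrite /gromov (distxx hd) (distC hd y x); lia. Qed.

Lemma gp_base_r x y : gp y x x = 0.
Proof. rewrite /gromov (distxx hd); lia. Qed.

(** The error does not accumulate: seen from the point n+1, the points 0 and n have product at least
    two steps minus 11h, so n can be exchanged for 0 in the local bound 10h at the cost of a single
    [h]. *)
Lemma local_one_sided g x : 1000 * h <= d x (g * x)%g ->
  gp (g^-1 * x)%g (g * x)%g x <= 10 * h ->
  forall n, 0 <= n -> gp (orb g x 0) (orb g x (n + 1)) (orb g x n) <= 11 * h.
Proof.
move=> big loc; have h0 := hyp_gt0 hd.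
apply: natlike_ind => [|n n0 IH]; first by rewrite gp_base_l; lia.
have loc' : gp (orb g x n) (orb g x (Z.succ n + 1)) (orb g x (Z.succ n)) <= 10 * h.
  rewrite (gp_orb g x (-1) (1) (0)); try lia.
  by rewrite orb1 orb0 /orb (zpowN g 1) zpow1.
have stp : d (orb g x n) (orb g x (Z.succ n)) = d x (g * x)%g.
  rewrite (dist_orb g x (0) (1)); last lia.
  by rewrite orb0 orb1.
have := gp_move hd _ (orb g x 0) _ _ _ loc'.
have := gp_compl hd (orb g x n) (orb g x 0) (orb g x (Z.succ n)).
rewrite (gpC hd (orb g x (Z.succ n))) stp -Z.add_1_r in IH *; lia.
Qed.

(** The one-sided estimate for g and for its inverse pushes out the two neighbours of [x] in turn,
    raising 10h to 11h and then to 12h. *)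
Lemma local_axis g x : 1000 * h <= d x (g * x)%g ->
  gp (g^-1 * x)%g (g * x)%g x <= 10 * h -> qaxis g x.
Proof.
move=> big loc; have h0 := hyp_gt0 hd; split=> // i k i0 k0.
have left := local_one_sided _ _ big loc _ i0.
have bigV : 1000 * h <= d x (g^-1 * x)%g.
  by rewrite -(distM hd g) mulVKg (distC hd).
have locV : gp (g^-1^-1 * x)%g (g^-1 * x)%g x <= 10 * h by rewrite invgK (gpC hd).
have right := local_one_sided _ _ bigV locV.
have leftS : gp (orb g x (- i)) (orb g x 1) x <= 11 * h.
  rewrite -{3}(orb0 g x) (gp_orb g x (0) (i + 1) (i)) //; lia.
have [->|k1] : k = 0 \/ 1 <= k by lia.
  by rewrite orb0 gp_base_r; lia.
have := right (k - 1); rewrite !orbV => /(_ ltac:(lia)) rightk.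
have rightS : gp (orb g x 0) (orb g x k) (orb g x 1) <= 11 * h.
  rewrite (gpC hd) (gp_orb g x (- 0) (- (k - 1 + 1)) (-(k-1))) //; lia.
have := gp_move_r hd _ _ (orb g x k) _ _ leftS.
have := gp_compl hd (orb g x 1) (orb g x k) x.
rewrite orb0 in rightS; rewrite (distC hd _ x) orb1 in rightS *; lia.
Qed.

(** * Distances along a quasi-axis *)

Section Axis.
Variables (g o : G).
Hypothesis ax : qaxis g o.
Local Notation lam := (d o (g * o)%g).

Lemma axis_gp i j k : i <= j -> j <= k ->
  gp (orb g o i) (orb g o k) (orb g o j) <= 12 * h.
Proof.
case: ax => _ H ij jk.
rewrite (gp_orb g o (- (j - i)) (k - j) (0)); try lia.
by rewrite orb0; apply: H; lia.
Qed.

Lemma axisV : qaxis g^-1 o.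
Proof.
case: ax => big H; split.
  by rewrite -(distM hd g) mulVKg (distC hd).
by move=> i k i0 k0; rewrite !orbV Z.opp_involutive (gpC hd); apply: H.
Qed.

Lemma axis_orb i : qaxis g (orb g o i).
Proof.
case: ax => big H; split.
  by rewrite -orb1 orb_orb (dist_orb g o (0) (1)) ?orb0 ?orb1 //; lia.
by move=> j k j0 k0; rewrite !orb_orb; apply: axis_gp; lia.
Qed.

Lemma axis_step i : d (orb g o i) (orb g o (i + 1)) = lam.
Proof. by rewrite (dist_orb g o (0) (1)) ?orb0 ?orb1 //; lia. Qed.

Lemma axis_upper n : 0 <= n -> d o (orb g o n) <= n * lam.
Proof.
move: n; apply: natlike_ind => [|n n0 IH]; first by rewrite orb0 (distxx hd).
have := dist_triangle hd o (orb g o n) (orb g o (n + 1)).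
rewrite axis_step -Z.add_1_r; lia.
Qed.

Lemma axis_add i k : 0 <= i -> 0 <= k ->
  d o (orb g o i) + d o (orb g o k) - 12 * h <= d o (orb g o (i + k)).
Proof.
move=> i0 k0; have := axis_gp 0 i (i + k) i0 ltac:(lia).
rewrite /gromov orb0.
rewrite (distC hd (orb g o (i + k)) (orb g o i)).
rewrite (dist_orb g o (a := i) (b := i + k) 0 k) ?orb0; lia.
Qed.

Lemma axis_lower n : 0 <= n -> n * (lam - 12 * h) <= d o (orb g o n).
Proof.
move: n; apply: natlike_ind => [|n n0 IH]; first by rewrite orb0 (distxx hd).
have := axis_add n 1 n0; rewrite orb1 -Z.add_1_r; lia.
Qed.

Lemma axis_pow j : 1 <= j -> qaxis (zpow g j) o.
Proof.
move=> j1; case: (ax) => big H; have h0 := hyp_gt0 hd; split.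
  have [->|j2] : j = 1 \/ 2 <= j by lia.
    by rewrite zpow1.
  have := axis_lower j; have := Z.mul_le_mono_nonneg_r 2 j (lam - 12 * h).
  rewrite /orb; lia.
by move=> i k i0 k0; rewrite !orb_zpow Z.mul_opp_r; apply: H; lia.
Qed.

(** Only upward jumps are bounded, which suffices for a crossing from below; no monotonicity along
    the orbit is assumed. *)
Lemma Z_ivt (f : Z -> Z) s v j : 0 <= j -> 0 <= s ->
  (forall i, 0 <= i -> f (i + 1) <= f i + s) ->
  f 0 <= v <= f j -> exists i, 0 <= i <= j /\ v - s <= f i <= v.
Proof.
move=> j0 s0 st; move: j j0; apply: natlike_ind => [|j j0 IH] v0j.
  by exists 0; lia.
have [lt|le] := Z.le_gt_cases v (f j).
  have [|i ?] := IH; [lia|exists i; lia].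
by exists j; have := st j j0; rewrite -Z.add_1_r in v0j *; lia.
Qed.


Lemma axis_dist a b :
  Z.abs (a - b) * (lam - 12 * h) <= d (orb g o a) (orb g o b) <= Z.abs (a - b) * lam.
Proof.
have main c n : 0 <= n ->
    n * (lam - 12 * h) <= d (orb g o c) (orb g o (c + n)) <= n * lam.
  move=> n0; rewrite (dist_orb g o 0 n) ?orb0; last lia.
  by split; [apply: axis_lower|apply: axis_upper].
have [ab|ba] := Z.le_ge_cases a b.
  rewrite (_ : Z.abs (a - b) = b - a); last lia.
  by have := main a (b - a); rewrite (_ : a + (b - a) = b); lia.
rewrite (_ : Z.abs (a - b) = a - b) ?(distC hd (orb g o a)); last lia.
by have := main b (a - b); rewrite (_ : b + (a - b) = a); lia.
Qed.

(** The four-point inequality compares [z] with an orbit point at about the same distance from [o],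
    found up to one step. If [z] is farther from [o] than the end of the segment, that end works. *)
Lemma near_orbit k z C : 0 <= k -> 0 <= C -> gp o (orb g o k) z <= C ->
  exists i, 0 <= i <= k /\ d z (orb g o i) <= C + lam + 13 * h.
Proof.
move=> k0 C0 zC; have h0 := hyp_gt0 hd; have l0 := dist_ge0 hd o (g * o)%g.
have [far|close] := Z.le_gt_cases (d o (orb g o k)) (d o z).
  exists k; move: zC; rewrite /gromov (distC hd z (orb g o k)); lia.
have [||i [ik]] := Z_ivt (fun i => d o (orb g o i)) lam (d o z) k k0 l0.
- move=> i _; have := dist_triangle hd o (orb g o i) (orb g o (i + 1)).
  by rewrite axis_step; lia.
- by rewrite orb0 (distxx hd); have := dist_ge0 hd o z; lia.
- cbv beta => iz; exists i; split=> //; have := axis_gp 0 i k; rewrite orb0.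
  have := four_point hd z o (orb g o i) (orb g o k); move: zC; rewrite /gromov.
  rewrite (distC hd z o) (distC hd z (orb g o k)) (distC hd (orb g o i) (orb g o k)); lia.
Qed.

End Axis.

(** * Elements commuting with an element that has a quasi-axis *)

Section RootsAndCommutingElements.
Variables (g o : G).
Hypothesis ax : qaxis g o.
Local Notation lam := (d o (g * o)%g).

(** The translate of the axis by f is parallel to it: both ends of a long segment are displaced by
    only d(o, f o). Seen from f o, each end may be exchanged for its untranslated copy, so 12h
    becomes 14h and f o is near the orbit, with a bound independent of f. *)
Lemma commute_near_orbit f : commute f g ->
  exists i, d (f * o)%g (orb g o i) <= lam + 27 * h.
Proof.
move=> cfg; have h0 := hyp_gt0 hd; have [big _] := ax.
set y := (f * o)%g; pose E := d o y; pose n := E + 20 * h + 1.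
have E0 : 0 <= E by apply: (dist_ge0 hd).
have far : n <= d o (orb g o n) by have := axis_lower g o ax n; nia.
have fo i : orb g y i = (f * orb g o i)%g.
  by rewrite /orb /y mulgA (zpow_commute _ _ _ (commute_sym cfg)) -mulgA.
have nr i : i = n \/ i = - n -> gp (f * orb g o i)%g (orb g o i) y > 14 * h.
  move=> ni; have := gp_near hd (f * orb g o i)%g (orb g o i) y.
  have -> : d (f * orb g o i)%g (orb g o i) = E.
    by rewrite -fo /orb (distM hd) (distC hd).
  rewrite /y (distM hd).
  suff -> : d (orb g o i) o = d o (orb g o n) by lia.
  case: ni => ->; first by rewrite (distC hd).
  by rewrite -{2 3}(orb0 g o) (dist_orb g o 0 n) //; lia.
have : gp (f * orb g o (- n))%g (f * orb g o n)%g y <= 12 * h.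
  by rewrite /y (gpM hd); case: ax => _; apply; lia.
move=> /(gp_move hd _ (orb g o (- n))) l1.
have {}l1 : gp (orb g o (- n)) (f * orb g o n)%g y <= 13 * h.
  by have := nr (- n); lia.
have {}l1 := gp_move_r hd _ _ (orb g o n) _ _ l1.
have {l1} l2 : gp (orb g o (- n)) (orb g o n) y <= 14 * h.
  by have := nr n; lia.
have e2 : orb g o n = orb g (orb g o (- n)) (2 * n).
  by rewrite orb_orb; congr orb; lia.
rewrite e2 in l2; have n0 : 0 <= 2 * n by lia.
have h14 : 0 <= 14 * h by lia.
have [i [_]] := near_orbit _ _ (axis_orb g o ax (- n)) _ _ _ n0 h14 l2.
rewrite orb_orb -orb1 orb_orb (dist_orb g o 0 1) ?orb0 ?orb1; last lia.
by exists (i + - n); lia.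
Qed.

(** Since a commutes with g, the point a^j o is near some g^i o. Taking K-th powers compares g^j o
    with g^(i K) o, and the linear lower bound along the axis forces i K to be close to j. *)
Lemma root_near_orbit a K : 1 <= K -> g = zpow a K ->
  forall j, exists i, d (orb a o j) (orb g o i) <= 2 * lam /\ Z.abs (j - i * K) <= 2 * K.
Proof.
move=> K1 gE j; have h0 := hyp_gt0 hd; have [big _] := ax.
have cag : commute (zpow a j) g.
  by rewrite gE; apply: zpow_commute2; apply: commute_refl.
have [i ji] := commute_near_orbit _ cag; exists i; split; first by rewrite /orb in ji *; lia.
have it r : 0 <= r -> d (orb a o (j * r)) (orb g o (i * r)) <= r * (lam + 27 * h).
  move: r; apply: natlike_ind => [|r r0 IH].
    by rewrite !Z.mul_0_r !orb0 (distxx hd).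
  have e1 : orb a o (j * Z.succ r) = (zpow a (j * r) * orb a o j)%g.
    by rewrite -orbD; congr orb; lia.
  have e2 : orb g o (i * Z.succ r) = (zpow g i * orb g o (i * r))%g.
    by rewrite -orbD; congr orb; lia.
  have e3 : (zpow a (j * r) * orb g o i = zpow g i * orb a o (j * r))%g.
    rewrite /orb !mulgA; congr (_ * _)%g.
    by rewrite gE -zpowM; apply: zpow_commute2; apply: commute_refl.
  have := dist_triangle hd (orb a o (j * Z.succ r)) (zpow a (j * r) * orb g o i)%g
    (orb g o (i * Z.succ r)).
  rewrite {2}e3 e2 (distM hd) e1 (distM hd); rewrite /orb in ji IH *; lia.
have := it K; rewrite (_ : orb a o (j * K) = orb g o j); last first.
  by rewrite /orb gE -zpowM Z.mul_comm.
have [low _] := axis_dist g o ax j (i * K).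
have [//|far] := Z.le_gt_cases (Z.abs (j - i * K)) (2 * K).
have : (2 * K + 1) * (lam - 12 * h) <= Z.abs (j - i * K) * (lam - 12 * h).
  by apply: Z.mul_le_mono_nonneg_r; lia.
have : K * (1000 * h) <= K * lam by apply: Z.mul_le_mono_nonneg_l; lia.
nia.
Qed.

End RootsAndCommutingElements.

(** Only the product at [z] is small; [z] may be far from every orbit point compared with [h]. The
    bounds still do not involve the step, which keeps the pigeonhole of [overlap] in a ball
    independent of the axis. *)
Lemma translate_along g o s j z : qaxis g o -> 0 <= s -> 0 <= j ->
  gp o (orb g o j) z <= 14 * h ->
  d o (orb g o s) + 200 * h <= d z (orb g o j) ->
  Z.abs (d z (orb g z s) - d o (orb g o s)) <= 100 * h /\
  gp z (orb g o j) (orb g z s) <= 200 * h.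
Proof.
move=> ax s0 j0 near room; have h0 := hyp_gt0 hd.
set t := d o (orb g o s) in room *; set f := orb g o s; set e := orb g o j.
set w := orb g z s; set e3 := orb g o (j + s).
have fw : d f w = d o z by rewrite /f /w (distM hd).
have we3 : d w e3 = d z e by rewrite /w /e3 Z.add_comm orbD (distM hd).
have fe3 : d f e3 = d o e.
  by rewrite /f /e3 /e (dist_orb g o 0 j) ?orb0 //; lia.
have ee3 : d e e3 = t.
  by rewrite /e /e3 /t (dist_orb g o 0 s) ?orb0 //; lia.
have g1 : gp o e3 f <= 12 * h.
  by have := axis_gp g o ax 0 s (j + s); rewrite orb0; apply; lia.
have g2 : gp o e3 e <= 12 * h.
  by have := axis_gp g o ax 0 j (j + s); rewrite orb0; apply; lia.
have q1 := four_point hd z o w e3; have q2 := four_point hd w z e e3.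
have t1 := dist_triangle hd o f w; have t2 := dist_triangle hd z e e3.
have t3 := dist_triangle hd o z w; have t4 := dist_triangle hd o w e3.
have t5 := dist_triangle hd o z e3; have t6 := dist_triangle hd o z e.
have t7 := dist_triangle hd z w e; have t8 := dist_triangle hd z w e3.
rewrite -/e -/t -/w in near room *.
have s1 := distC hd e3 f; have s2 := distC hd e3 e; have s3 := distC hd e z.
have s4 := distC hd z o; have s5 := distC hd w z; have s6 := distC hd e w.
have s7 := distC hd e3 w; have s8 := distC hd e3 z.
have tE : d o f = t by []. have t0 := dist_ge0 hd o f.
move: near g1 g2; rewrite /gromov -/t -/f; lia.
Qed.

Lemma fellow_points z e w w' : d w w' <= gp z e w + gp z e w' + Z.abs (d z w - d z w') + h.
Proof.
have := four_point hd w z w' e; have := dist_triangle hd z w e.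
have := dist_triangle hd z w' e; rewrite /gromov.
rewrite (distC hd w z) (distC hd w e) (distC hd w' e) (distC hd z w'); lia.
Qed.

End QuasiAxes.

Arguments dist_orb {G d h} hd g x {a b} a' b' _.
Arguments gp_orb {G d h} hd g x {a b c} a' b' c' _ _.

(** * Uniform existence of axes and overlaps *)

Section UniformAxes.
Context {G : groupType} {d : G -> G -> Z} {h : Z}.
Hypothesis hd : hyperbolic_metric d h.
Local Open Scope Z_scope.
Local Notation gp := (gromov d).
Local Notation qaxis := (@qaxis G d h).
Implicit Types (x y z o g : G).

Lemma ball_pigeonhole r : exists N, 1 <= N /\ forall f : Z -> G,
  (forall i, 1 <= i <= N -> d 1%g (f i) <= r) ->
  exists i j, 1 <= i /\ i < j /\ j <= N /\ f i = f j.
Proof.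
have [s sP] := finite_balls hd r.
exists (Z.of_nat (size s).+1); split=> [|f fr]; first lia.
pose t := [seq f (Z.of_nat i.+1) | i <- iota 0 (size s).+1].
have [|nu] := boolP (uniq t).
  move=> ut; have : (size t <= size s)%N.
    apply: uniq_leq_size ut _ => _ /mapP[i + ->]; rewrite mem_iota add0n => /andP[_ /ltP li].
    by apply: sP; apply: fr; lia.
  by rewrite size_map size_iota ltnn.
have /(uniqPn 1%g)[i [j [ij jt]]] := nu.
move: jt; rewrite size_map size_iota => jt.
have it := ltn_trans ij jt.
rewrite !(nth_map 0%N) ?size_iota // !nth_iota // !add0n => e.
exists (Z.of_nat i.+1), (Z.of_nat j.+1).
by move/ltP: ij; move/ltP: jt => jt ij; split; [lia|split; [lia|split; [lia|]]].
Qed.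

Lemma orbit_unbounded a r : infinite_order a ->
  exists n, 1 <= n /\ r < d 1%g (zpow a n).
Proof.
move=> oa; have [N [N1 pig]] := ball_pigeonhole r.
apply: contrapT => no; have [i|i [j [i1 [ij [jN e]]]]] := pig (zpow a).
  have [//|? iN] := Z.le_gt_cases (d 1%g (zpow a i)) r.
  by case: no; exists i; lia.
by have := zpow_inj _ _ _ oa e; lia.
Qed.

(* Either p and q lie on both sides of m along the geodesic, or they fold together. *)
Lemma three_on_geodesic o e p m q : gp o e m = 0 -> gp o e p <= 2 * h ->
  gp o e q <= 2 * h -> d p m = d m q -> d p q <= 10 * h \/ gp p q m <= 10 * h.
Proof.
have h0 := hyp_gt0 hd.
rewrite /gromov => em ep eq pmq.
have q1 := four_point hd m o q e; have q2 := four_point hd m o p e.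
have q3 := four_point hd p o q e.
have t1 := dist_triangle hd o m q; have t2 := dist_triangle hd o q m.
have t3 := dist_triangle hd o m p; have t4 := dist_triangle hd o p m.
have t5 := dist_triangle hd o p q; have t6 := dist_triangle hd o q p.
have t7 := dist_triangle hd o p e; have t8 := dist_triangle hd o q e.
have s1 := distC hd m o; have s2 := distC hd q e; have s3 := distC hd o p.
have s4 := distC hd m e; have s5 := distC hd o q; have s6 := distC hd p e.
have s7 := distC hd q m; have s8 := distC hd p m; have s9 := distC hd p q.
lia.
Qed.

(** The base point is the midpoint m of a very long geodesic from 1 to some a^n. For |k| at most N,
    a^k moves both ends by at most [Q], which is negligible seen from m, so a^k m stays near the
    geodesic. N depends only on a ball of radius 2010h, not on a. *)
Lemma axis_of_power : exists N, 1 <= N /\ forall a, infinite_order a ->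
  exists k x, 1 <= k <= N /\ qaxis (zpow a k) x.
Proof.
have h0 := hyp_gt0 hd.
have [N [N1 pig]] := ball_pigeonhole (2010 * h); exists N; split=> // a oa.
pose Q := N * d 1%g a.
have [n [n1 far]] := orbit_unbounded a (4 * Q + 10 * h) oa.
set e := zpow a n in far.
have Q0 : 0 <= Q by apply: Z.mul_nonneg_nonneg; [lia|exact: (dist_ge0 hd)].
have aQ k : Z.abs k <= N -> d 1%g (zpow a k) <= Q.
  move=> kN; suff up i : 0 <= i <= N -> d 1%g (zpow a i) <= Q.
    have [k0|k0] := Z.le_ge_cases 0 k; first by apply: up; lia.
    rewrite -(distM hd (zpow a (- k))) -zpowD mulg1 Z.add_opp_diag_l (distC hd).
    by apply: up; lia.
  move=> iN; have := axis_upper hd a 1%g i; rewrite /orb !mulg1.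
  have := dist_ge0 hd 1%g a; rewrite /Q; nia.
have half : 0 <= d 1%g e / 2 /\ d 1%g e - 1 <= 2 * (d 1%g e / 2) <= d 1%g e.
  have := Z.div_mod (d 1%g e) 2; have := Z.mod_pos_bound (d 1%g e) 2; lia.
have [m [m1 m2]] := dist_between hd 1%g e (d 1%g e / 2) ltac:(lia).
have near k : Z.abs k <= N -> gp 1%g e (zpow a k * m)%g <= 2 * h.
  move=> kN; have c0 : gp (zpow a k * 1)%g (zpow a k * e)%g (zpow a k * m)%g <= 0.
    by rewrite (gpM hd) /gromov (distC hd e m) m1 m2; lia.
  have l1 := gp_near hd (zpow a k * 1)%g 1%g (zpow a k * m)%g.
  have l2 := gp_near hd (zpow a k * e)%g e (zpow a k * m)%g.
  have ake : d (zpow a k * e)%g e = d 1%g (zpow a k).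
    by rewrite /e -zpowD Z.add_comm zpowD -{2}(mulg1 (zpow a n)) (distM hd) (distC hd).
  rewrite !(distM hd) ake (distC hd _ 1%g) mulg1 in l1 l2.
  rewrite (distC hd e m) in l2; rewrite mulg1 in c0.
  have := aQ k kN.
  have := gp_move hd _ 1%g _ _ _ c0 => /(_ ltac:(have := aQ k kN; lia)) c1.
  have := gp_move_r hd _ _ e _ _ c1; lia.
(* Otherwise two of the conjugates of a^(2k) by m would coincide. Being more than 2010h apart, a^-k
   m and a^k m cannot fold together, and the step of a^k at m exceeds 1000h. *)
have [k [kN kfar]] : exists k, 1 <= k <= N /\ 2010 * h < d m (zpow a (2 * k) * m)%g.
  apply: contrapT => no.
  have [k kN|i [j [i1 [ij [jN eq]]]]] := pig (fun k => (m^-1 * zpow a (2 * k) * m)%g).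
    rewrite -(distM hd m) mulg1 -mulgA mulVKg.
    by have [//|?] := Z.le_gt_cases (d m (zpow a (2 * k) * m)%g) (2010 * h);
      case: no; exists k.
  have := zpow_inj _ _ _ oa (mulgI _ _ _ (mulIg _ _ _ eq)); lia.
have pq : d (zpow a (- k) * m)%g (zpow a k * m)%g = d m (zpow a (2 * k) * m)%g.
  rewrite -(distM hd (zpow a k)) !mulgA -!zpowD Z.add_opp_diag_r mul1g.
  by congr (d _ (zpow _ _ * _)%g); lia.
have pm : d (zpow a (- k) * m)%g m = d m (zpow a k * m)%g.
  by rewrite -(distM hd (zpow a k)) !mulgA -!zpowD Z.add_opp_diag_r mul1g.
have e0 : gp 1%g e m = 0 by rewrite /gromov (distC hd e m); lia.
have [||l|l] := three_on_geodesic _ _ _ _ _ e0 (near (- k) _) (near k _) pm; try lia.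
exists k, m; split; first lia; apply: (local_axis hd); last by rewrite -zpowN.
have := dist_triangle hd (zpow a (- k) * m)%g m (zpow a k * m)%g; lia.
Qed.

Lemma uniform_axis_power : exists K, 1 <= K /\ forall a, infinite_order a ->
  exists x, qaxis (zpow a K) x.
Proof.
have [N [N1 ax]] := axis_of_power.
(* A common multiple of all exponents up to N; positive powers keep a quasi-axis. *)
exists (Z.of_nat (Z.to_nat N)`!); split.
  by have /ltP := fact_gt0 (Z.to_nat N); lia.
move=> a /ax[k [x [kN axk]]]; exists x.
have /dvdnP[q Kq] : (Z.to_nat k %| (Z.to_nat N)`!)%N.
  by apply: dvdn_fact; apply/andP; split; [apply/ltP|apply/leP]; lia.
have /ltP := fact_gt0 (Z.to_nat N); rewrite {}Kq -multE => q0.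
have -> : Z.of_nat (Nat.mul q (Z.to_nat k)) = k * Z.of_nat q by lia.
by rewrite zpowM; apply: (axis_pow hd) => //; nia.
Qed.

Lemma orb_conj f g x i : orb (f * g * f^-1)%g (f * x)%g i = (f * orb g x i)%g.
Proof. by rewrite /orb zpow_conj -!mulgA mulKg. Qed.

Lemma axis_conj f g x : qaxis g x -> qaxis (f * g * f^-1)%g (f * x)%g.
Proof.
case=> big H; split; first by rewrite -!mulgA mulKg (distM hd).
by move=> i k i0 k0; rewrite !orb_conj (gpM hd); apply: H.
Qed.

(* The elements b1^-s (g b2 g^-1)^s move the middle of the overlap by a bounded
   amount, so two of them coincide. *)
Lemma overlap : exists N, 1 <= N /\
  forall b1 b2 o g j j' D, qaxis b1 o -> qaxis b2 o ->
    (forall s, 0 <= s -> d o (orb b1 o s) = d o (orb b2 o s)) ->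
    0 <= j -> 0 <= j' -> 0 <= D ->
    d o (g * o)%g <= D -> d (orb b1 o j) (g * orb b2 o j')%g <= D ->
    3 * D + (N + 10) * d o (b1 * o)%g <= d o (orb b1 o j) ->
    exists p, 1 <= p /\ (g * zpow b2 p * g^-1)%g = zpow b1 p.
Proof.
have h0 := hyp_gt0 hd.
have [N [N1 pig]] := ball_pigeonhole (1000 * h); exists N; split=> //.
move=> b1 b2 o g j j' D ax1 ax2 same j0 j'0 D0 near0 nearj long.
pose c := (g * b2 * g^-1)%g.
have axc : qaxis c (g * o)%g by apply: axis_conj.
set lam := d o (b1 * o)%g in long.
have lam0 : 1000 * h <= lam by case: ax1.
(* The point z is at least D + 2 lam from [o] and leaves room for N steps before the end e. Seen
   from z, displacing either end by D therefore costs only one [h]. *)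
have [|||i [ij]] := Z_ivt (fun i => d o (orb b1 o i)) lam (D + 3 * lam) j j0.
- lia.
- move=> i _; have := dist_triangle hd o (orb b1 o i) (orb b1 o (i + 1)).
  by rewrite (axis_step hd) -/lam; lia.
- rewrite orb0 (distxx hd); nia.
cbv beta; set z := orb b1 o i => oz; set e := orb b1 o j in nearj long *.
pose e2 := orb c (g * o)%g j'; have e2E : e2 = (g * orb b2 o j')%g by rewrite /e2 orb_conj.
rewrite -e2E in nearj.
have ze : d o e - d o z <= d z e by have := dist_triangle hd o z e; lia.
have near1 : gp o e z <= 12 * h.
  by have := axis_gp hd _ _ ax1 0 i j; rewrite orb0; apply; lia.
have near2 : gp (g * o)%g e2 z <= 14 * h.
  have := gp_near hd o (g * o)%g z; have := gp_near hd e e2 z.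
  rewrite (distC hd e z) => l1 l2.
  have := gp_move hd _ (g * o)%g _ _ _ near1 => /(_ ltac:(nia)) c1.
  have := gp_move_r hd _ _ e2 _ _ c1 => /(_ ltac:(nia)) c2; lia.
have ze2 : d z e - D <= d z e2.
  by have := dist_triangle hd z e2 e; rewrite (distC hd e2 e); lia.
(* By [same], both translates have moved from z towards e by equal lengths up to multiples of [h],
   so they are close whatever the step is. *)
have close s : 1 <= s <= N -> d (zpow b1 s * z)%g (zpow c s * z)%g <= 1000 * h.
  move=> sN; have tup : d o (orb b1 o s) <= N * lam.
    have := axis_upper hd b1 o s; rewrite -/lam; nia.
  have te : d (g * o)%g (orb c (g * o)%g s) = d o (orb b1 o s).
    by rewrite orb_conj (distM hd) same //; lia.
  have [||zt1 zt2] := translate_along hd _ _ s j' z axc _ j'0 near2.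
  - lia.
  - by rewrite te -/e2; lia.
  rewrite te -/(orb c z s) in zt1 zt2 *; set w' := orb c z s in zt1 zt2 *.
  have wE : (zpow b1 s * z)%g = orb b1 o (s + i) by rewrite orbD.
  have dzw : d z (orb b1 o (s + i)) = d o (orb b1 o s).
    by rewrite /z (dist_orb hd b1 o (a := i) (b := s + i) 0 s) ?orb0 //; lia.
  have sij : s + i <= j.
    have [//|sij] := Z.le_gt_cases (s + i) j.
    have : d z e <= (j - i) * lam.
      have := axis_upper hd b1 o (j - i).
      by rewrite /z /e (dist_orb hd b1 o (a := i) (b := j) 0 (j - i)) ?orb0 -/lam //; lia.
    nia.
  have g1 : gp z e (orb b1 o (s + i)) <= 12 * h by apply: (axis_gp hd) => //; lia.
  have g2 : gp z e w' <= 201 * h.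
    have := gp_move_r hd _ _ e _ _ zt2.
    have := gp_near hd e2 e w'; rewrite -/e2 (distC hd e2 e) => n1 n2.
    have := dist_triangle hd z w' e2; rewrite (distC hd w' e2); nia.
  rewrite wE; have := fellow_points hd z e (orb b1 o (s + i)) w'; lia.
have [s sN|s [s' [s1 [ss' [s'N eq]]]]] :=
    pig (fun s => (z^-1 * (zpow b1 (- s) * zpow c s) * z)%g).
  rewrite -(distM hd (zpow b1 s * z)%g) mulg1.
  rewrite -(mulgA z^-1) -(mulgA (zpow b1 s) z) mulVKg -(mulgA (zpow b1 (- s))).
  by rewrite (zpowN b1) mulVKg; apply: close.
move/(mulIg _ _ _)/(mulgI _ _ _): eq => eq.
exists (s' - s); split; first lia.
rewrite -zpow_conj -/c.
have -> : s' - s = s' + - s by lia.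
have e3 : zpow b1 (- s) = (zpow b1 (- s') * zpow c s' * zpow c (- s))%g.
  by rewrite -eq -mulgA -zpowD Z.add_opp_diag_r mulg1.
by rewrite (zpowD b1) e3 -(mulgA (zpow b1 (- s'))) (zpowN b1) mulVKg -zpowD.
Qed.
End UniformAxes.

(** * Commuting powers *)

Section Generated.
Context {G : groupType}.
Implicit Types (A K : set G) (x y : G).

Lemma generated_subgroup A : is_subgroup (generated A).
Proof.
split=> [K [[]]//|x y xA yA K [sK AK]|x xA K [sK AK]].
- by case: (sK) => _ KM _; apply: KM; [apply: xA|apply: yA].
- by case: (sK) => _ _ KV; apply: KV; apply: xA.
Qed.

Lemma sub_generated A : A `<=` generated A.
Proof. by move=> x Ax K [_]; apply. Qed.

Lemma generated_sub A K : is_subgroup K -> A `<=` K -> generated A `<=` K.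
Proof. by move=> sK AK x; apply. Qed.

Lemma subgroup_zpow K x i : is_subgroup K -> K x -> K (zpow x i).
Proof.
move=> [K1 KM KV] Kx; have KX n : K (x ^+ n).
  by elim: n => [|n IH]; rewrite ?expg0 // expgS; apply: KM.
by have [[n ->]|[n ->]] := Z_natP i; rewrite ?zpowN zpow_nat //; apply: KV.
Qed.

Lemma centralizer_subgroup x : is_subgroup [set y | commute x y].
Proof.
by split=> [|y z|y]; [exact: commute1|exact: commuteM|exact: commuteV].
Qed.

Lemma left_coset_mul K f k : is_subgroup K -> K k ->
  left_coset (f * k) K = left_coset f K.
Proof.
move=> [_ KM KV] Kk; apply/seteqP; split=> _ [y Ky <-].
- by exists (k * y); [apply: KM|rewrite mulgA].
- by exists (k^-1 * y); [apply: KM => //; apply: KV|rewrite -mulgA mulVKg].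
Qed.

End Generated.

(** * Commuting powers generate an elementary subgroup *)

Section Elementary.
Context {G : groupType} {d : G -> G -> Z} {h : Z}.
Hypothesis hd : hyperbolic_metric d h.
Local Notation qaxis := (@qaxis G d h).
Local Open Scope Z_scope.
Implicit Types (x y z o g : G).

(** Each b^s x is near some orbit point g^(t s) x, so g^(-t s) b^s takes the same value for two
    exponents s. The resulting exponent of g is nonzero because b has infinite order. *)
Lemma power_in_axis_orbit g x b : qaxis g x -> infinite_order b -> commute g b ->
  exists m u, 1 <= m /\ 1 <= u /\ (zpow b m = zpow g u \/ zpow b m = zpow g (- u)).
Proof.
move=> ax ob cgb.
have orbP s : exists t, d (zpow b s * x)%g (orb g x t) <= d x (g * x)%g + 27 * h.
  by apply: (commute_near_orbit hd) ax _ _; apply: zpow_commute; apply/commute_sym.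
have [t tP] := choice orbP.
have [N [N1 pig]] := ball_pigeonhole hd (d x (g * x)%g + 27 * h).
have [s sN|s [s' [s1 [ss' [s'N eq]]]]] :=
    pig (fun s => (x^-1 * (zpow g (- t s) * zpow b s) * x)%g).
  rewrite -(distM hd (zpow g (t s) * x)%g) mulg1.
  rewrite -(mulgA x^-1) -(mulgA (zpow g (t s)) x) mulVKg -(mulgA (zpow g (- t s))).
  by rewrite (zpowN g) mulVKg (distC hd); apply: tP.
move/(mulIg _ _ _)/(mulgI _ _ _): eq => eq.
have e : zpow b (s' - s) = zpow g (t s' - t s).
  have -> : t s' - t s = t s' + - t s by lia.
  have e3 : zpow g (- t s) = (zpow g (- t s') * zpow b s' * zpow b (- s))%g.
    by rewrite -eq -mulgA -zpowD Z.add_opp_diag_r mulg1.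
  by rewrite (zpowD g) e3 -(mulgA (zpow g (- t s'))) (zpowN g) mulVKg -zpowD Z.add_opp_r.
have nz : t s' - t s <> 0.
  by move=> z0; have := infinite_order_zpow _ _ ob (etrans e (congr1 (zpow g) z0)); lia.
exists (s' - s), (Z.abs (t s' - t s)); split; first lia; split; first lia.
have [?|?] := Z.le_ge_cases 0 (t s' - t s).
  by left; rewrite e; congr zpow; lia.
by right; rewrite e; congr zpow; lia.
Qed.

(** A power c of a that is also a power of b is central in the subgroup and has a quasi-axis. Every
    element then differs by a power of c from one that moves [x] by a bounded amount, and there are
    finitely many of these. *)
Lemma commuting_powers_elementary (a b : G) i j : infinite_order a -> infinite_order b ->
  1 <= i -> 1 <= j -> commute (zpow a i) (zpow b j) -> elementary (generated [set a; b]).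
Proof.
move=> oa ob i1 j1 cab.
have [K [K1 axK]] := uniform_axis_power hd.
have [x axa] := axK a oa.
have ax : qaxis (zpow a (K * i)) x by rewrite zpowM; apply: (axis_pow hd).
have obj : infinite_order (zpow b j).
  move=> n n0; rewrite -zpow_nat -zpowM => /(infinite_order_zpow _ _ ob).
  by move/ltP: n0; nia.
have cg : commute (zpow a (K * i)) (zpow b j).
  by rewrite Z.mul_comm zpowM; apply: zpow_commute.
have [m [u [m1 [u1 bg]]]] := power_in_axis_orbit _ _ _ ax obj cg.
pose c := zpow a (K * i * u).
have axc : qaxis c x by rewrite /c zpowM; apply: (axis_pow hd).
have cb : commute c b.
  case: bg => bg.
    rewrite /c zpowM -bg -zpowM; apply: zpow_commute; exact: commute_refl.
  rewrite /c -(Z.opp_involutive (_ * u)) zpowN -Z.mul_opp_r zpowM -bg -zpowM.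
  by apply/commute_sym/commuteV/commute_sym; apply: zpow_commute; exact: commute_refl.
have ca : commute c a by apply: zpow_commute; exact: commute_refl.
have Hc : generated [set a; b] c.
  by apply: (subgroup_zpow (generated [set a; b]) _ _ (generated_subgroup _));
    apply: sub_generated; left.
have cH y : generated [set a; b] y -> commute c y.
  apply: (generated_sub _ [set y | commute c y] (centralizer_subgroup c)) => _ [->|->] //.
exists c => //; have [s sP] := finite_balls hd (d x (c * x)%g + 27 * h).
pose C := generated [set c].
(* The finite ball is centred at 1, whence the conjugation by x. *)
apply: (@sub_finite_set _ _ [set left_coset (x * y * x^-1)%g C | y in [set` s]]); last first.
  exact/finite_image/finite_seq.
move=> _ [y Hy <-].
have [t ty] := commute_near_orbit hd _ _ axc y (commute_sym (cH y Hy)).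
exists (x^-1 * (y * zpow c (- t)) * x)%g.
  apply: sP.
  have -> : (y * zpow c (- t) = zpow c (- t) * y)%g.
    by apply/commute_sym/zpow_commute/cH.
  rewrite -(distM hd (zpow c t * x)%g) mulg1.
  rewrite -(mulgA x^-1) -(mulgA (zpow c t) x) mulVKg -(mulgA (zpow c (- t))).
  by rewrite (zpowN c) mulVKg (distC hd).
rewrite !mulgA mulgV mul1g mulgK; apply: left_coset_mul; first exact: generated_subgroup.
by apply: (subgroup_zpow C _ _ (generated_subgroup _)); exact: sub_generated.
Qed.

End Elementary.

(** * Bounded overlaps of an axis with its translates *)

Section Overlaps.
Context {G : groupType} {d : G -> G -> Z} {h : Z}.
Hypothesis hd : hyperbolic_metric d h.
Local Open Scope Z_scope.
Local Notation gp := (gromov d).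
Local Notation qaxis := (@qaxis G d h).
Implicit Types (x y z o g a b u w p : G).

Lemma Z_argmin (T : Type) (f : T -> Z) (t0 : T) : (forall t, 0 <= f t) ->
  exists t, forall t', f t <= f t'.
Proof.
move=> f0; apply: contrapT => no.
suff none n : 0 <= n -> forall t, n < f t by have := none (f t0) (f0 t0) t0; lia.
move: n; apply: natlike_ind => [|n n0 IH] t.
  have [t1|t1] := Z.le_gt_cases (f t) 0; first by case: no; exists t => t'; have := f0 t'; lia.
  lia.
have [t1|t1] := Z.le_gt_cases (f t) (Z.succ n); last lia.
by case: no; exists t => t'; have := IH t'; lia.
Qed.

Lemma near_orbit_Z g o k z C : qaxis g o -> 0 <= C -> gp o (orb g o k) z <= C ->
  exists i, d z (orb g o i) <= C + d o (g * o)%g + 13 * h.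
Proof.
move=> ax C0 zC; have [k0|k0] := Z.le_ge_cases 0 k.
  by have [i [_ ?]] := near_orbit hd _ _ ax _ _ _ k0 C0 zC; exists i.
have -> : d o (g * o)%g = d o (g^-1 * o)%g.
  by rewrite -[RHS](distM hd g) mulVKg (distC hd).
have [||i [_ ?]] := near_orbit hd _ _ (axisV hd _ _ ax) (- k) z C _ C0; first lia.
  by rewrite orbV Z.opp_involutive.
by exists (- i); rewrite -orbV.
Qed.

Lemma axis_intermediate g o k v : qaxis g o -> 0 <= v <= d o (orb g o k) ->
  exists i, v - d o (g * o)%g <= d o (orb g o i) <= v /\
    gp o (orb g o k) (orb g o i) <= 12 * h.
Proof.
have main f j : qaxis f o -> 0 <= j -> 0 <= v <= d o (orb f o j) ->
    exists i, v - d o (f * o)%g <= d o (orb f o i) <= v /\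
    gp o (orb f o j) (orb f o i) <= 12 * h.
  move=> ax j0 vk.
  have [|||i [ik iv]] := Z_ivt (fun i => d o (orb f o i)) (d o (f * o)%g) v j j0.
  - exact: (dist_ge0 hd).
  - move=> i _; have := dist_triangle hd o (orb f o i) (orb f o (i + 1)).
    by rewrite (axis_step hd); lia.
  - by rewrite orb0 (distxx hd).
  exists i; split=> //; have := axis_gp hd _ _ ax 0 i j; rewrite orb0; apply; lia.
move=> ax vk; have [k0|k0] := Z.le_ge_cases 0 k; first exact: main.
have [||i] := main _ (- k) (axisV hd _ _ ax); first lia.
  by rewrite orbV Z.opp_involutive.
rewrite !orbV Z.opp_involutive -(distM hd g o (g^-1 * o)%g) mulVKg (distC hd (g * o)%g) => ?.
by exists (- i).
Qed.

(** Up to half their doubled product at [o], the directions to u and p agree, so a point near one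
    geodesic is near the other. *)
Lemma between_points o u y p : gp o u y <= 12 * h -> 2 * d o y <= gp u p o ->
  gp o p y <= 13 * h.
Proof.
have := hyp_gt0 hd; have := four_point hd y o p u; rewrite /gromov.
rewrite (distC hd u o) (distC hd p o) (distC hd y o) (distC hd y u) (distC hd u p).
rewrite (distC hd p y); lia.
Qed.

Lemma conj_same_power_commute g b1 b2 b (p : Z) :
  (b1 = b \/ b1 = b^-1)%g -> (b2 = b \/ b2 = b^-1)%g ->
  (g * zpow b2 p * g^-1)%g = zpow b1 p -> commute (g * g)%g (zpow b p).
Proof.
move=> b1E b2E e; apply/commute_sym.
have [{}e|{}e] : (g * zpow b p * g^-1)%g = zpow b p \/ (g * zpow b p * g^-1)%g = (zpow b p)^-1%g.
  case: b1E b2E e => -> [] ->; rewrite ?zpowV ?zpowN; try by [left|right].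
    by move/(congr1 (fun x => x^-1)%g); rewrite !invgM !invgK mulgA; right.
  by move/(congr1 (fun x => x^-1)%g); rewrite !invgM !invgK mulgA; left.
- have c : commute g (zpow b p) by rewrite /commute -{2}e mulgVK.
  exact/commuteM/commute_sym/c/commute_sym.
- rewrite /commute; have e1 : (g * zpow b p = (zpow b p)^-1 * g)%g by rewrite -e mulgVK.
  have e' : (g * (zpow b p)^-1 * g^-1)%g = zpow b p.
    by move: (congr1 (fun x => x^-1)%g e); rewrite !invgM !invgK mulgA.
  have e2 : (g * (zpow b p)^-1 = zpow b p * g)%g by rewrite -[in RHS]e' mulgVK.
  by rewrite -[RHS]mulgA e1 [RHS]mulgA e2 mulgA.
Qed.

(* c stands for the constant of the lemma overlap. *)
Definition few_overlaps (c : Z) a b o :=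
  forall g D s s', (exists2 i, i <> 0 & g = zpow a i) -> 0 <= D ->
    d o (g * o)%g <= D -> d (orb b o s) (g * orb b o s')%g <= D ->
    d o (orb b o s) < 3 * D + (c + 10) * d o (b * o)%g.

(** A longer overlap with the translate by a^i would make a^(2i) commute with a power of b. *)
Lemma few_overlapsP : exists c, 1 <= c /\ forall a b K o, 1 <= K ->
  (forall i j, 1 <= i -> 1 <= j -> ~ commute (zpow a i) (zpow b j)) ->
  qaxis (zpow b K) o -> few_overlaps c a (zpow b K) o.
Proof.
have [N [N1 ov]] := overlap hd; exists N; split=> // a b K o K1 nc ax g D s s'.
case=> i i0 gE D0 near0 nears; set lam := d o (zpow b K * o)%g.
have [long|?] := Z.le_gt_cases (3 * D + (N + 10) * lam) (d o (orb (zpow b K) o s)); last lia.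
(* The constant [N] comes from [overlap], which takes nonnegative exponents; signs are absorbed into
   b^K or its inverse, which displace [o] equally. *)
pose sg (t : Z) := if 0 <=? t then zpow b K else (zpow b K)^-1%g.
have sgP t : sg t = zpow b K \/ sg t = (zpow b K)^-1%g.
  by rewrite /sg; case: (0 <=? t); [left|right].
have sg_axis t : qaxis (sg t) o by case: (sgP t) => ->; [|exact: (axisV hd)].
have sg_orb t : orb (sg t) o (Z.abs t) = orb (zpow b K) o t.
  by rewrite /sg; case: (Z.leb_spec 0 t) => ?; rewrite ?orbV; congr orb; lia.
have dV t : d o (orb (zpow b K)^-1%g o t) = d o (orb (zpow b K) o t).
  by rewrite orbV -{1}(orb0 (zpow b K) o) (dist_orb hd _ o t 0) ?orb0 ?(distC hd o) //; lia.
have sgd t r : d o (orb (sg t) o r) = d o (orb (zpow b K) o r).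
  by case: (sgP t) => ->.
have [|||||||p [p1 pE]] := ov (sg s) (sg s') o g (Z.abs s) (Z.abs s') D (sg_axis s) (sg_axis s').
- by move=> t _; rewrite !sgd.
- lia.
- lia.
- by [].
- by [].
- by rewrite !sg_orb.
- by rewrite sg_orb -orb1 sgd orb1.
have := conj_same_power_commute _ _ _ _ _ (sgP s) (sgP s') pE.
rewrite gE -zpowD -zpowM => c.
case: (nc (Z.abs (i + i)) (K * p)) => //; try nia.
have [?|?] := Z.le_ge_cases 0 i; first by rewrite Z.abs_eq //; lia.
rewrite Z.abs_neq ?zpowN; last lia.
exact/commute_sym/commuteV/commute_sym.
Qed.

End Overlaps.

(** * Two axes *)

Section TwoAxes.
Context {G : groupType} {d : G -> G -> Z} {h : Z}.
Hypothesis hd : hyperbolic_metric d h.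
Local Open Scope Z_scope.
Local Notation gp := (gromov d).
Local Notation qaxis := (@qaxis G d h).
Variables (a b o o' : G) (K c : Z).
Local Notation alpha := (zpow a K).
Local Notation beta := (zpow b K).
Local Notation la := (d o' (alpha * o')%g).
Local Notation lb := (d o (beta * o)%g).
Hypotheses (K1 : 1 <= K) (c1 : 1 <= c).
Hypotheses (axa : qaxis alpha o') (axb : qaxis beta o) (lab : la <= lb).
Hypothesis closest : forall i j, d o o' <= d (orb beta o i) (orb alpha o' j).
Hypothesis ov : few_overlaps (d := d) c a beta o.
Implicit Types (i j k l : Z).

Lemma a_near l : exists i,
  d (orb a o' l) (orb alpha o' i) <= 2 * la /\ Z.abs (l - i * K) <= 2 * K.
Proof. exact: (root_near_orbit hd _ _ axa a K K1 erefl). Qed.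

Lemma b_near l : exists i,
  d (orb b o l) (orb beta o i) <= 2 * lb /\ Z.abs (l - i * K) <= 2 * K.
Proof. exact: (root_near_orbit hd _ _ axb b K K1 erefl). Qed.

(** The exponent l need not be a multiple of [K]: g^l o1 is within two steps of an orbit point of
    g^K whose exponent is at most 2 away from l / K. This explains r + 2 and the two steps
    subtracted. *)
Lemma long_power g o1 l : qaxis (zpow g K) o1 ->
  forall r, 0 <= r -> (r + 2) * K <= Z.abs l ->
  r * (d o1 (zpow g K * o1)%g - 12 * h) - 2 * d o1 (zpow g K * o1)%g <= d o1 (orb g o1 l).
Proof.
move=> ax r r0 rl; have h0 := hyp_gt0 hd; have [big _] := ax.
have [i [near iK]] := root_near_orbit hd _ _ ax g K K1 erefl l.
have ri : r <= Z.abs i by nia.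
have [low _] := axis_dist hd _ _ ax i 0.
rewrite orb0 Z.sub_0_r in low; set lam := d o1 _ in big near low *.
have : r * (lam - 12 * h) <= Z.abs i * (lam - 12 * h) by apply: Z.mul_le_mono_nonneg_r; lia.
have := dist_triangle hd o1 (orb g o1 l) (orb (zpow g K) o1 i).
rewrite (distC hd _ o1) in low; lia.
Qed.

(** Otherwise an orbit point between [lb] and 2 [lb] away from [o] would lie almost on the way to o'
    and be nearer to it than [o]. *)
Lemma closest_gp_b i : gp (orb beta o i) o' o <= 4 * lb.
Proof.
have h0 := hyp_gt0 hd; have [big _] := axb.
have [//|far] := Z.le_gt_cases (gp (orb beta o i) o' o) (4 * lb).
have := gp_le hd (orb beta o i) o' o; rewrite (distC hd _ o) => far'.
have [|j [dj gj]] := axis_intermediate hd _ _ i (2 * lb) axb; first lia.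
have := between_points hd _ _ _ o' gj ltac:(lia).
have := closest j 0; rewrite orb0 /gromov (distC hd o' (orb beta o j)); lia.
Qed.

Lemma closest_gp_a j : gp (orb alpha o' j) o o' <= 4 * la.
Proof.
have h0 := hyp_gt0 hd; have [big _] := axa.
have [//|far] := Z.le_gt_cases (gp (orb alpha o' j) o o') (4 * la).
have := gp_le hd (orb alpha o' j) o o'; rewrite (distC hd _ o') => far'.
have [|i [di gi]] := axis_intermediate hd _ _ j (2 * la) axa; first lia.
have := between_points hd _ _ _ o gi ltac:(lia).
have := closest 0 i; rewrite orb0 /gromov (distC hd o' o); lia.
Qed.

Lemma closest_gp_b' l : gp (orb b o l) o' o <= 8 * lb.
Proof.
have [i [near _]] := b_near l; have := closest_gp_b i.
have := gp_lip hd (orb beta o i) (orb b o l) o' o.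
by rewrite (distC hd _ (orb b o l)); lia.
Qed.

Lemma closest_gp_a' l : gp (orb a o' l) o o' <= 8 * la.
Proof.
have [i [near _]] := a_near l; have := closest_gp_a i.
have := gp_lip hd (orb alpha o' i) (orb a o' l) o o'.
by rewrite (distC hd _ (orb a o' l)); lia.
Qed.

(** A long bridge joins the axes. The broken line b^l o, o, o', a^k o', a^k o, a^k b^l' o bends by
    at most 8 [lb] or 8 [la], and its inner segments are long, the middle one because |k| is at
    least 64 K; exchanging endpoints carries the bound from vertex to vertex. *)
Lemma pingpong_far k l l' : 20 * lb < d o o' -> 64 * K <= Z.abs k ->
  gp (orb b o l) (zpow a k * orb b o l')%g o <= 9 * lb.
Proof.
move=> far kbig; have h0 := hyp_gt0 hd; have [bigb _] := axb; have [biga _] := axa.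
set u := orb b o l; set w := (zpow a k * orb b o l')%g.
set p' := orb a o' k; set p := (zpow a k * o)%g.
have g1 : gp p' w p <= 8 * lb.
  by rewrite /p' /w /p (gpM hd) (gpC hd); apply: closest_gp_b'.
have pp' : d p p' = d o o' by rewrite /p /p' (distM hd).
have := gp_compl hd p w p'; rewrite pp' => e1.
have g2 : gp o' p p' <= 8 * la.
  rewrite -(gpM hd (zpow a (- k))) /p' /p !mulgA -!zpowD Z.add_opp_diag_l !mul1g.
  exact: closest_gp_a'.
have g3 : gp o' w p' <= 8 * la + h.
  by apply: (gp_move_r hd _ _ w _ _ g2); lia.
have o'p' : 50 * la <= d o' p'.
  by have := long_power a o' k axa 62 ltac:(lia) ltac:(lia); rewrite -/p'; lia.
have := gp_compl hd o' w p' => e2.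
have g4 : gp p' o o' <= 8 * la by apply: closest_gp_a'.
have g5 : gp o w o' <= 8 * la + h.
  rewrite (gpC hd) in g4; apply: (gp_move_r hd _ _ w _ _ g4); lia.
have := gp_compl hd o w o' => e3.
have g6 : gp u o' o <= 8 * lb by apply: closest_gp_b'.
have := gp_move_r hd _ _ w _ _ g6; lia.
Qed.

Section Near.
Hypothesis near : d o o' <= 20 * lb.

(** A large product would put a distant orbit point y of beta near the axis of alpha too. As [la] is
    at most [lb], alpha would move both [o] and y by at most 86 [lb], against [few_overlaps]. *)
Lemma near_gp_axes i j : gp (orb beta o i) (orb alpha o' j) o <= (2 * c + 540) * lb.
Proof.
have h0 := hyp_gt0 hd; have [bigb _] := axb; have [biga _] := axa.
set u := orb beta o i; set p := orb alpha o' j.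
have [//|far] := Z.le_gt_cases (gp u p o) ((2 * c + 540) * lb).
have := gp_le hd u p o; rewrite (distC hd _ o) => far'.
have cl : 0 <= c * lb by apply: Z.mul_nonneg_nonneg; lia.
(* With D = 86 lb, the excluded length is 3 D + (c + 10) lb = (c + 268) lb; an orbit point is found
   up to one step. *)
have [|s [ds gs]] := axis_intermediate hd _ _ i ((c + 270) * lb) axb; first by rewrite -/u; lia.
set y := orb beta o s in ds gs.
have yp : gp o p y <= 13 * h by apply: (between_points hd _ u) => //; lia.
have yp' : gp o' p y <= 41 * lb.
  by have := gp_lip hd o o' p y; lia.
have [||t yt] := near_orbit_Z hd _ _ j y (41 * lb) axa; first lia.
  exact: yp'.
have ta : d (orb alpha o' t) (alpha * orb alpha o' t)%g = la.
  by rewrite -orb1 orb_orb Z.add_comm (axis_step hd).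
have near0 : d o (alpha * o)%g <= 85 * lb.
  have := dist_triangle hd o o' (alpha * o)%g.
  have := dist_triangle hd o' (alpha * o')%g (alpha * o)%g.
  by rewrite (distM hd) (distC hd o' o); lia.
have nears : d y (alpha * y)%g <= 86 * lb.
  have := dist_triangle hd y (orb alpha o' t) (alpha * y)%g.
  have := dist_triangle hd (orb alpha o' t) (alpha * orb alpha o' t)%g (alpha * y)%g.
  rewrite (distM hd) ta (distC hd (orb alpha o' t) y); lia.
have K0 : exists2 k, k <> 0 & alpha = zpow a k by exists K => //; lia.
have := ov alpha (86 * lb) s s K0 ltac:(lia) ltac:(lia) nears; rewrite -/y; lia.
Qed.

(** The additional 48 [lb] pay for passing from powers of alpha and beta to all powers, and from o'
    to [o]. *)
Lemma near_gp_powers k l : gp (orb b o l) (zpow a k * o)%g o <= (2 * c + 588) * lb.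
Proof.
have [i [ni _]] := b_near l; have [j [nj _]] := a_near k.
have := near_gp_axes i j.
have := gp_lip hd (orb beta o i) (orb b o l) (orb alpha o' j) o.
have := gp_lip_r hd (orb b o l) (orb alpha o' j) (zpow a k * o)%g o.
have := dist_triangle hd (orb alpha o' j) (orb a o' k) (zpow a k * o)%g.
rewrite (distC hd (orb alpha o' j) (orb a o' k)) (distC hd (orb beta o i)).
rewrite (distM hd) (distC hd o' o); lia.
Qed.

(** Here a^k may hardly move [o]. If the product were large, the small products at [o] and at a^k o
    would bound d(o, a^k o); the axis of beta and its translate by a^k would then run together,
    against [few_overlaps] for g = a^k. *)
Lemma pingpong_near k l l' : k <> 0 ->
  gp (orb b o l) (zpow a k * orb b o l')%g o <= (26 * c + 7110) * lb.
Proof.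
move=> k0; have h0 := hyp_gt0 hd; have [bigb _] := axb.
have cl : lb <= c * lb by nia.
set u := orb b o l; set g := zpow a k; set w := (g * orb b o l')%g; set p := (g * o)%g.
have [//|far] := Z.le_gt_cases (gp u w o) ((26 * c + 7110) * lb).
have up : gp u p o <= (2 * c + 588) * lb by apply: near_gp_powers.
have owp : gp o w p <= (2 * c + 588) * lb.
  rewrite -(gpM hd (zpow a (- k))) /w /p /g !mulgA -!zpowD Z.add_opp_diag_l !mul1g.
  by rewrite (gpC hd); apply: near_gp_powers.
have wpo : gp w p o <= (2 * c + 589) * lb.
  by have := gp_move hd _ w _ _ _ up; lia.
have op : 2 * d o p <= (4 * c + 1177) * lb.
  by have := gp_compl hd o w p; rewrite (gpC hd p w); lia.
have [i [ni _]] := b_near l; have [i' [ni' _]] := b_near l'.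
set u2 := orb beta o i in ni; pose w2 := (g * orb beta o i')%g.
have ww2 : d w w2 <= 2 * lb by rewrite /w /w2 (distM hd).
have far2 : (26 * c + 7102) * lb <= gp u2 w2 o.
  have := gp_lip hd u2 u w o; have := gp_lip_r hd u2 w2 w o.
  by rewrite (distC hd u2) (distC hd w2) -/u in ni *; lia.
have := gp_le hd u2 w2 o; rewrite (distC hd u2) => far3.
(* With D = (4 c + 1180) lb, the excluded length is 3 D + (c + 10) lb = (13 c + 3550) lb, plus one
   step. Doubling it and adding 8 lb for the passage from b to beta gives the constant of the
   statement. *)
have [|s [ds gs]] := axis_intermediate hd _ _ i ((13 * c + 3551) * lb) axb.
  by rewrite -/u2; lia.
set y := orb beta o s in ds gs; rewrite -/u2 in gs.
have ywo : gp o w2 y <= 13 * h.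
  by apply: (between_points hd _ u2) => //; lia.
have ywp : gp p w2 y <= (4 * c + 1178) * lb by have := gp_lip hd o p w2 y; lia.
have gK : (g * (zpow a (- k) * y))%g = y by rewrite /g mulgA -zpowD Z.add_opp_diag_r mul1g.
have gy : gp o (orb beta o i') (zpow a (- k) * y)%g <= (4 * c + 1178) * lb.
  by rewrite -(gpM hd g) gK.
have [|t yt] := near_orbit_Z hd _ _ _ _ _ axb _ gy; first nia.
rewrite -(distM hd g) gK in yt.
have k0' : exists2 i, i <> 0 & g = zpow a i by exists k.
have := ov g ((4 * c + 1180) * lb) s t k0' ltac:(nia)
  ltac:(rewrite -/p; nia) ltac:(rewrite -/y; nia).
by rewrite -/y; nia.
Qed.
End Near.

Lemma pingpong_products k l l' : 64 * K <= Z.abs k ->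
  gp (orb b o l) (zpow a k * orb b o l')%g o <= (26 * c + 7110) * lb.
Proof.
move=> kbig; have h0 := hyp_gt0 hd; have [bigb _] := axb.
have [nr|fr] := Z.le_gt_cases (d o o') (20 * lb); first by apply: pingpong_near => //; nia.
have := pingpong_far k l l' fr kbig; nia.
Qed.

End TwoAxes.

(** * Ping-pong *)

Section PingPong.
Context {G : groupType} {d : G -> G -> Z} {h : Z}.
Hypothesis hd : hyperbolic_metric d h.
Local Open Scope Z_scope.
Local Notation gp := (gromov d).
Local Notation qaxis := (@qaxis G d h).
Implicit Types (x y o g : G).

(* Nothing is asked of the length of A^k o: it may be short compared with the overlap
   of the two axes, and then the powers of B alone make a word progress. *)
Definition pingpong (A B o : G) (R : Z) :=
  [/\ 0 <= R,
   forall k l l', k <> 0 -> l <> 0 ->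
     gp (orb B o l) (zpow A k * orb B o l')%g o <= R &
   forall l, l <> 0 -> 10 * R + 100 * h <= d o (orb B o l)].

Definition no_commuting_powers (a b : G) :=
  forall i j, 1 <= i -> 1 <= j -> ~ commute (zpow a i) (zpow b j).

(** The element whose K-th power has the longer step plays the role of B. That choice depends on the
    axes of a and b but not on n and m, so the disjunction stands outside. *)
Lemma pingpong_large_powers : exists M : nat, forall a b : G,
  infinite_order a -> infinite_order b -> no_commuting_powers a b ->
  (forall n m : nat, (M <= n)%N -> (M <= m)%N ->
     exists o R, pingpong (a ^+ n)%g (b ^+ m)%g o R) \/
  (forall n m : nat, (M <= n)%N -> (M <= m)%N ->
     exists o R, pingpong (b ^+ m)%g (a ^+ n)%g o R).
Proof.
have h0 := hyp_gt0 hd.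
have [K [K1 axK]] := uniform_axis_power hd.
have [c [c1 few]] := few_overlapsP hd.
pose C := 26 * c + 7110.
(* So many steps exceed, after the losses in [long_power], the 10 R + 100 h asked of B with R = C
   lb; M is also at least the 64 K asked of A. *)
pose M := Z.to_nat (K * (12 * C + 70)); exists M.
have main (a b x y : G) : qaxis (zpow a K) x -> qaxis (zpow b K) y ->
    d x (zpow a K * x)%g <= d y (zpow b K * y)%g -> no_commuting_powers a b ->
    forall n m : nat, (M <= n)%N -> (M <= m)%N ->
    exists o R, pingpong (a ^+ n)%g (b ^+ m)%g o R.
  move=> axa axb lab nc n m /leP Mn /leP Mm.
  (* The base points move along their orbits to a closest pair, which exists because distances are
     nonnegative integers. Quasi-axes and steps are preserved. *)
  have [[i j]] := Z_argmin (Z * Z) (fun p => d (orb (zpow b K) y p.1) (orb (zpow a K) x p.2))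
    (0, 0) (fun p => dist_ge0 hd _ _).
  set o := orb (zpow b K) y i; set o' := orb (zpow a K) x j => min.
  have {}axa : qaxis (zpow a K) o' by apply: (axis_orb hd).
  have {}axb : qaxis (zpow b K) o by apply: (axis_orb hd).
  have {}lab : d o' (zpow a K * o')%g <= d o (zpow b K * o)%g.
    by rewrite /o /o' -!orb1 !orb_orb !(Z.add_comm 1) !(axis_step hd).
  have closest i' j' : d o o' <= d (orb (zpow b K) o i') (orb (zpow a K) o' j').
    by rewrite /o /o' !orb_orb; apply: (min (_, _)).
  have ov := few a b K o K1 nc axb.
  set lb := d o (zpow b K * o)%g in lab; have [bigb _] := axb; rewrite -/lb in bigb.
  have orbX g x1 (r : nat) l : orb (g ^+ r)%g x1 l = orb g x1 (Z.of_nat r * l).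
    by rewrite -zpow_nat orb_zpow.
  have big (r : nat) k : (M <= r)%coq_nat -> k <> 0 ->
      (12 * C + 70) * K <= Z.abs (Z.of_nat r * k).
    by move=> Mr k0; rewrite Z.abs_mul; nia.
  exists o, (C * lb); split; first nia.
  - move=> k l l' k0 l0; rewrite !orbX.
    rewrite (_ : zpow (a ^+ n)%g k = zpow a (Z.of_nat n * k)); last first.
      by rewrite -zpow_nat zpowM.
    apply: (pingpong_products hd _ _ _ o' K c) => //.
    have := big n k Mn k0; nia.
  - move=> l l0; rewrite orbX.
    have := long_power hd K K1 b o (Z.of_nat m * l) axb (12 * C + 60) ltac:(lia).
    have := big m l Mm l0; rewrite -/lb; nia.
move=> a b oa ob nc; have [x axa] := axK a oa; have [y axb] := axK b ob.
have [l|l] := Z.le_ge_cases (d x (zpow a K * x)%g) (d y (zpow b K * y)%g).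
  by left; apply: (main _ _ x y).
right => n m Mn Mm; apply: (main _ _ y x) => //.
by move=> i j i1 j1 /commute_sym; apply: nc.
Qed.

(** Large exponents grow linearly along the quasi-axis of A^K, up to the change of base point; for
    small nonzero ones it is enough that the distance is at least 1. L depends on A and o. *)
Lemma infinite_order_linear_growth (A o : G) : infinite_order A ->
  exists L, 1 <= L /\ forall k, Z.abs k <= L * d o (orb A o k).
Proof.
move=> oA; have h0 := hyp_gt0 hd; have [K [K1 axK]] := uniform_axis_power hd.
have [x ax] := axK A oA; have [big _] := ax; set lam := d x _ in big.
have D0 := dist_ge0 hd x o.
pose L := K * (2 * lam + 2 * d x o + 6); exists L; split; first by rewrite /L; nia.
move=> k; have [->|k0] := Z.eq_dec k 0; first by rewrite orb0 (distxx hd); nia.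
have dk : 1 <= d o (orb A o k).
  have := dist_ge0 hd o (orb A o k).
  have [e|] := Z.eq_dec (d o (orb A o k)) 0; last lia.
  have /esym e1 := dist_eq0 hd _ _ e.
  by case: k0; apply: (infinite_order_zpow A) => //; apply: (mulIg o); rewrite mul1g.
have [small|large] := Z.le_gt_cases (Z.abs k) (2 * K); first by rewrite /L; nia.
pose r := Z.abs k / K - 2.
have rk : (r + 2) * K <= Z.abs k < (r + 3) * K.
  have := Z.div_mod (Z.abs k) K; have := Z.mod_pos_bound (Z.abs k) K; rewrite /r; nia.
have r0 : 0 <= r by nia.
have low := long_power hd K K1 A x k ax r r0 (proj1 rk).
rewrite -/lam in low.
have far : d x (orb A x k) <= d o (orb A o k) + 2 * d x o.
  have := dist_triangle hd x o (orb A x k); have := dist_triangle hd o (orb A o k) (orb A x k).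
  by rewrite /orb (distM hd) (distC hd o x); lia.
have rl : r <= r * (lam - 12 * h) by nia.
have : r + 3 <= (2 * lam + 2 * d x o + 6) * d o (orb A o k) by nia.
rewrite /L; nia.
Qed.

Section AlternatingWords.
Variables (A B o : G) (R L : Z).
Hypothesis pp : pingpong A B o R.
Hypothesis growA : forall k, Z.abs k <= L * d o (orb A o k).
Hypothesis growB : forall k, Z.abs k <= L * d o (orb B o k).
Hypothesis L1 : 1 <= L.

(* The integer counts the letters; the last power of A may be trivial. *)
Inductive alternating : G -> Z -> Prop :=
| AltEnd j : alternating (zpow A j) (Z.abs j)
| AltCons k l g n : k <> 0 -> l <> 0 -> alternating g n ->
    alternating (zpow A k * (zpow B l * g))%g (Z.abs k + Z.abs l + n).

(** The product bound limits the backtracking when a syllable of B is prepended, so both claims go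
    through one induction. Each new pair of syllables loses at most 2R + 2h, less than half the
    displacement by B^l; hence the factor 2. *)
Lemma alternatingP g n : alternating g n ->
  (forall l, l <> 0 -> gp (orb B o l) (g * o)%g o <= R + h) /\
  n <= 2 * L * d o (g * o)%g.
Proof.
have h0 := hyp_gt0 hd; have [R0 ppR long] := pp.
have gpA l j : l <> 0 -> gp (orb B o l) (zpow A j * o)%g o <= R.
  move=> l0; have [->|j0] := Z.eq_dec j 0; first by rewrite mul1g (gp_base_r hd).
  by have := ppR j l 0 j0 l0; rewrite orb0.
elim=> {g n} [j|k l g n k0 l0 _ [IHgp IHn]].
  split=> [l /gpA|]; first by move=> /(_ j); lia.
  have := growA j; rewrite /orb; have := dist_ge0 hd o (zpow A j * o)%g; nia.
set q := (zpow A k * (zpow B l * o))%g.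
set e := (_ * (_ * g) * o)%g; have eE : e = (zpow A k * (zpow B l * (g * o)))%g.
  by rewrite /e !mulgA.
(* Translating the junction q to [o] turns the starting point into X = B^-l A^-k o. Its direction
   agrees with that of B^-l o, for which the induction hypothesis bounds the product with the
   tail. *)
have back : gp o e q <= R + 2 * h.
  pose X := (zpow B (- l) * (zpow A (- k) * o))%g.
  have -> : gp o e q = gp X (g * o)%g o.
    rewrite -(gpM hd (zpow A k * zpow B l)%g X) eE /q /X !mulgA.
    by rewrite !zpowN mulgK mulgV mul1g.
  have Vl : - l <> 0 by lia.
  apply: Z.le_trans (_ : R + h + h <= _); last lia.
  apply: (gp_move hd _ _ _ _ _ (IHgp (- l) Vl)).
  have := gp_compl hd (orb B o (- l)) X o.
  have -> : gp o X (orb B o (- l)) =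
            gp (orb B o l) (zpow A (- k) * o)%g o.
    by rewrite -(gpM hd (zpow B l)) /X /orb !zpowN !mulVKg.
  have := gpA l (- k) l0; have := long (- l) Vl; rewrite (distC hd o (orb B o (- l))).
  lia.
have oq : d o (orb A o k) + d o (orb B o l) - R <= d o q.
  have := gpA l (- k) l0; rewrite /gromov.
  rewrite -(distM hd (zpow A k) (orb B o l) (zpow A (- k) * o)%g).
  rewrite (distC hd (_ * orb B o l)%g) zpowN mulVKg -/q.
  rewrite -(distM hd (zpow A k) ((zpow A k)^-1 * o)%g) mulVKg.
  by rewrite /orb (distC hd (zpow B l * o)%g); rewrite /q; lia.
have lB := long l l0; have dA := dist_ge0 hd o (orb A o k).
have gq := gp_compl hd o e q; rewrite (gpC hd q e) in gq.
split=> [l1 l10|].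
  have g1 := ppR k l1 l k0 l10; rewrite -/(orb B o l) in g1.
  apply: (gp_move_r hd _ q _ _ _ g1); have := gp_compl hd q e o.
  by rewrite (distC hd q o); lia.
have eq : d q e = d o (g * o)%g by rewrite /q eE !(distM hd).
have len : d o (orb A o k) + d o (g * o)%g + d o (orb B o l) - 2 * R - 2 * h <= d o e.
  by move: back; rewrite /gromov (distC hd e q); lia.
have := growA k; have := growB l; nia.
Qed.

Lemma syllable_growth l g n : alternating g n ->
  Z.abs l + n <= 2 * L * d o (zpow B l * g * o)%g.
Proof.
have h0 := hyp_gt0 hd; have [R0 ppR long] := pp.
move=> /alternatingP[gpB ng].
have [->|l0] := Z.eq_dec l 0; first by rewrite mul1g; lia.
have := gpB (- l) ltac:(lia); rewrite /gromov.
rewrite -(distM hd (zpow B l) (orb B o (- l)) o).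
rewrite -(distM hd (zpow B l) (orb B o (- l)) (g * o)%g).
rewrite /orb zpowN mulVKg mulgA (distC hd (g * o)%g) -/(orb B o l).
move=> gp_l; have lB := long l l0; have gB := growB l.
have gpl : d o (orb B o l) + d o (g * o)%g - d o (zpow B l * g * o)%g <= R + h by exact: gp_l.
have dd : d o (orb B o l) + 2 * d o (g * o)%g <= 2 * d o (zpow B l * g * o)%g by lia.
nia.
Qed.

End AlternatingWords.
End PingPong.

(** * Reduced words *)

Section Words.
Context {G : groupType}.
Implicit Types (A B x y g : G) (w : seq (G * bool)).

Definition letter_sign (s : bool) : Z := if s then 1%Z else (-1)%Z.

Lemma letter_valE (l : G * bool) : letter_val l = zpow l.1 (letter_sign l.2).
Proof. by case: l => x [] /=; rewrite /letter_val /letter_sign /= Pos2Nat.inj_1. Qed.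

Lemma word_val_nil : word_val [::] = 1 :> G.
Proof. by rewrite /word_val big_nil. Qed.

Lemma word_val_cons (l : G * bool) w : word_val (l :: w) = letter_val l * word_val w.
Proof. by rewrite /word_val big_cons. Qed.

Lemma word_val_cat w w' : word_val (w ++ w') = word_val w * word_val w'.
Proof. by rewrite /word_val big_cat. Qed.

Definition word_on A B w := forall l, l \in w -> l.1 = A \/ l.1 = B.

Lemma word_on_cons A B l w : word_on A B (l :: w) -> (l.1 = A \/ l.1 = B) /\ word_on A B w.
Proof.
by move=> on; split=> [|l' l'w]; apply: on; rewrite in_cons ?eqxx ?l'w ?orbT.
Qed.

(** Adjacent letters of a reduced word on the same generator have the same sign, so the exponent of
    a syllable counts its letters exactly. A leading syllable of B is kept apart because
    [alternating] starts with a power of A. *)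
Lemma reduced_syllables A B (x : G * bool) w : A <> B -> reduced (x :: w) -> word_on A B (x :: w) ->
  (x.1 = A -> exists j y n, [/\ (1 <= j)%Z,
     word_val (x :: w) = zpow A (letter_sign x.2 * j) * y,
     Z.of_nat (size (x :: w)) = (j + n)%Z &
     (y = 1 /\ n = 0%Z) \/ (exists l g n', [/\ l <> 0%Z, alternating A B g n',
        y = zpow B l * g & n = (Z.abs l + n')%Z])]) /\
  (x.1 = B -> exists j g n, [/\ (1 <= j)%Z,
     word_val (x :: w) = zpow B (letter_sign x.2 * j) * g,
     Z.of_nat (size (x :: w)) = (j + n)%Z & alternating A B g n]).
Proof.
move=> AB; elim: w x => [|x' w IH] x.
  move=> _ _; rewrite word_val_cons word_val_nil letter_valE.
  by split=> <-; exists 1%Z, 1; [exists 0%Z|exists (Z.abs 0)]; rewrite Z.mul_1_r;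
    split=> //; [left|exact: (AltEnd _ _ 0)].
move=> red0 on; have /= /andP[x'x red] := red0; have {on} [_ on] := word_on_cons _ _ _ _ on.
have [IHA IHB] := IH x' red on.
have sg0 s (j : Z) : (1 <= j -> letter_sign s * j <> 0 /\ Z.abs (letter_sign s * j) = j)%Z.
  by case: s; rewrite /letter_sign; lia.
have same : x'.1 = x.1 -> x'.2 = x.2.
  move=> e1; case: (boolP (x'.2 == x.2)) => [/eqP//|/negPf e2].
  move: x'x; rewrite -pair_eqE /pair_eq /= e1 eqxx /=.
  by case: (x'.2) e2 => []; case: (x.2).
have step (C : G) j y : x.1 = C -> x'.1 = C ->
    word_val (x' :: w) = zpow C (letter_sign x'.2 * j) * y ->
    word_val (x :: x' :: w) = zpow C (letter_sign x.2 * (j + 1)) * y.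
  move=> xC x'C e; rewrite word_val_cons e letter_valE xC (same _) ?xC // mulgA -zpowD.
  by congr (zpow _ _ * _); lia.
have [x'A|x'B] : x'.1 = A \/ x'.1 = B by apply: on; rewrite mem_head.
- have [j [y [n [j1 e sz yn]]]] := IHA x'A; have [nz ab] := sg0 x'.2 j j1.
  split=> [xA|xB].
    exists (j + 1)%Z, y, n; split=> //; [lia|exact: step|].
    by rewrite /= in sz; lia.
  exists 1%Z, (word_val (x' :: w)), (j + n)%Z; split=> //.
  + by rewrite word_val_cons letter_valE xB Z.mul_1_r.
  + by rewrite /= in sz; lia.
  + rewrite e; case: yn => [[-> ->]|[l [g [n' [l0 alt -> ->]]]]].
      by rewrite mulg1 Z.add_0_r -{2}ab; apply: AltEnd.
    by rewrite -{2}ab Z.add_assoc; apply: AltCons.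
- have [j [g [n [j1 e sz alt]]]] := IHB x'B; have [nz ab] := sg0 x'.2 j j1.
  split=> [xA|xB]; last first.
    exists (j + 1)%Z, g, n; split=> //; [lia|exact: step|].
    by rewrite /= in sz; lia.
  exists 1%Z, (word_val (x' :: w)), (j + n)%Z; split=> //.
  + by rewrite word_val_cons letter_valE xA Z.mul_1_r.
  + by rewrite /= in sz; lia.
  + by right; exists (letter_sign x'.2 * j)%Z, g, n; rewrite e ab.
Qed.

Lemma reduced_alternating A B w : A <> B -> reduced w -> word_on A B w ->
  exists l g n, [/\ word_val w = zpow B l * g, alternating A B g n &
    Z.of_nat (size w) = (Z.abs l + n)%Z].
Proof.
move=> AB; case: w => [|x w] red on.
  exists 0%Z, 1, 0%Z; rewrite word_val_nil mul1g; split=> //; exact: (AltEnd _ _ 0).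
have [pA pB] := reduced_syllables _ _ _ _ AB red on.
have sg0 (j : Z) : (1 <= j -> letter_sign x.2 * j <> 0 /\ Z.abs (letter_sign x.2 * j) = j)%Z.
  by case: (x.2); rewrite /letter_sign; lia.
have [[xA|xB] _] := word_on_cons _ _ _ _ on.
  have [j [y [n [j1 e sz yn]]]] := pA xA; have [nz ab] := sg0 j j1.
  exists 0%Z, (word_val (x :: w)), (j + n)%Z; rewrite mul1g; split=> //.
  rewrite e; case: yn => [[-> ->]|[l [g [n' [l0 alt -> ->]]]]].
    by rewrite mulg1 Z.add_0_r -{2}ab; apply: AltEnd.
  by rewrite -{2}ab Z.add_assoc; apply: AltCons.
have [j [g [n [j1 e sz alt]]]] := pB xB; have [nz ab] := sg0 j j1.
by exists (letter_sign x.2 * j)%Z, g, n; rewrite e ab.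
Qed.

Lemma reduced_take i w : reduced w -> reduced (take i w).
Proof. exact: take_sorted. Qed.

Lemma reduced_drop i w : reduced w -> reduced (drop i w).
Proof. exact: drop_sorted. Qed.

Lemma reduced_word_exists A B w : word_on A B w ->
  exists w', [/\ word_on A B w', reduced w' & word_val w' = word_val w].
Proof.
elim: w => [|l w IH] on; first by exists [::].
have [lAB /IH[w' [on' red' e]]] := word_on_cons _ _ _ _ on.
have def : word_on A B (l :: w').
  by move=> l'; rewrite in_cons => /predU1P[->//|/on'].
case: w' => [|l' w'] in on' red' e def *.
  by exists [:: l]; rewrite !word_val_cons e.
case: (eqVneq l' (l.1, ~~ l.2)) => [l'l|l'l]; last first.
  by exists (l :: l' :: w'); split=> //=; rewrite ?l'l // !word_val_cons -e word_val_cons.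
exists w'; split; first by case/word_on_cons: on'.
  by move: red' => /path_sorted.
rewrite !word_val_cons -e word_val_cons !letter_valE l'l /= mulgA -zpowD.
by case: (l.2); rewrite mul1g.
Qed.

Lemma generated_word A B g : generated [set A; B] g ->
  exists w, [/\ word_on A B w, reduced w & word_val w = g].
Proof.
move=> Hg; suff [w [on <-]] : exists w, word_on A B w /\ word_val w = g.
  exact: reduced_word_exists.
move: g Hg; apply: (generated_sub _ [set g | exists w, word_on A B w /\ word_val w = g]).
  split=> [|x y [w [on <-]] [w' [on' <-]]|x [w [on <-]]].
  - by exists [::]; rewrite word_val_nil.
  - exists (w ++ w'); rewrite word_val_cat; split=> // l.
    by rewrite mem_cat => /orP[/on|/on'].
  - exists (rev [seq (l.1, ~~ l.2) | l <- w]); split.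
      by move=> l; rewrite mem_rev => /mapP[l' /on ? ->].
    elim: w {on} => [|l w IH]; first by rewrite /= word_val_nil invg1.
    rewrite /= rev_cons -cats1 word_val_cat IH !word_val_cons word_val_nil mulg1 invgM.
    by congr (_ * _); rewrite !letter_valE /= -zpowN; case: (l.2).
move=> x xAB; exists [:: (x, true)]; split; last by rewrite word_val_cons word_val_nil mulg1.
by move=> l; rewrite inE => /eqP ->; case: xAB => ->; [left|right].
Qed.

Lemma word_val_generated A B w : word_on A B w -> generated [set A; B] (word_val w).
Proof.
have sg := generated_subgroup [set A; B].
elim: w => [|l w IH] on; first by rewrite word_val_nil; case: sg.
have [lAB /IH Hw] := word_on_cons _ _ _ _ on.
rewrite word_val_cons letter_valE; case: (sg) => _ mulH _; apply: mulH => //.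
apply: (subgroup_zpow (generated [set A; B])) => //.
by apply: sub_generated; case: lAB => ->; [left|right].
Qed.

End Words.

(** * Linear growth of reduced words *)

Section PingPongWords.
Context {G : groupType} {d : G -> G -> Z} {h : Z}.
Hypothesis hd : hyperbolic_metric d h.
Local Open Scope Z_scope.

Lemma pingpong_reduced_growth (A B o : G) R : infinite_order A -> infinite_order B ->
  pingpong (d := d) (h := h) A B o R ->
  exists L, 1 <= L /\ forall w, reduced w -> word_on A B w ->
    Z.of_nat (size w) <= L * d o (word_val w * o)%g.
Proof.
move=> oA oB pp; have h0 := hyp_gt0 hd.
have [LA [LA1 growA]] := infinite_order_linear_growth hd A o oA.
have [LB [LB1 growB]] := infinite_order_linear_growth hd B o oB.
(* Otherwise the product of B o and A o seen from [o] would be 2 d(o, B o), far above R. *)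
have AB : A <> B.
  move=> AB; have [R0 ppR long] := pp.
  have := ppR 1 1 0 ltac:(lia) ltac:(lia); rewrite orb0 zpow1 orb1 AB /gromov (distxx hd).
  by have := long 1 ltac:(lia); rewrite orb1 (distC hd (B * o)%g); lia.
exists (2 * (LA + LB)); split=> [|w red on]; first lia.
have [l [g [n [-> alt ->]]]] := reduced_alternating _ _ _ AB red on.
apply: (syllable_growth hd _ _ _ _ _ pp) alt => [k|k|]; last lia.
  by have := growA k; have := dist_ge0 hd o (orb A o k); nia.
by have := growB k; have := dist_ge0 hd o (orb B o k); nia.
Qed.

End PingPongWords.

(** * Stability of quasi-geodesics *)

Section Morse.
Context {G : groupType} {d : G -> G -> Z} {h : Z}.
Hypothesis hd : hyperbolic_metric d h.
Local Open Scope Z_scope.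
Local Notation gp := (gromov d).
Implicit Types (x y z : G) (f : Z -> G).

Lemma square_le_pow2 t : 4 <= t -> t * t <= 2 ^ t.
Proof.
move=> t4; have -> : t = (t - 4) + 4 by lia.
move: (t - 4) (ltac:(lia) : 0 <= t - 4); apply: natlike_ind => [//|s s0 IH].
have -> : Z.succ s + 4 = Z.succ (s + 4) by lia.
rewrite Z.pow_succ_r; nia.
Qed.

Lemma linear_le_pow2 u v : exists t0, 1 <= t0 /\ forall t, t0 <= t -> u * t + v <= 2 ^ t.
Proof.
exists (4 + Z.abs u + Z.abs v); split=> [|t tt0]; first lia.
have := square_le_pow2 t ltac:(lia); nia.
Qed.

Definition quasi_geodesic (L C : Z) f n :=
  [/\ 0 <= n, forall i, 0 <= i < n -> d (f i) (f (i + 1)) <= L &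
      forall i j, 0 <= i <= j -> j <= n -> j - i <= L * (d (f i) (f j) + C)].

(** Dyadic subdivision: each halving costs one [h]. This is the exponential length of paths that
    avoid a ball about z. *)
Lemma chain_product f z t : 0 <= t -> forall i j, i < j -> j - i <= 2 ^ t ->
  exists k, i <= k < j /\ gp (f k) (f (k + 1)) z <= gp (f i) (f j) z + h * t.
Proof.
have h0 := hyp_gt0 hd.
move: t; apply: natlike_ind => [|t t0 IH] i j ij jt.
  by exists i; rewrite (_ : i + 1 = j); lia.
rewrite Z.pow_succ_r // in jt.
have [small|large] := Z.le_gt_cases (j - i) (2 ^ t).
  by have [k [? ?]] := IH i j ij small; exists k; nia.
have p0 : 0 < 2 ^ t by apply: Z.pow_pos_nonneg.
have := gp_four hd (f i) (f (i + 2 ^ t)) (f j) z.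
have [k [? ?]] := IH i (i + 2 ^ t) ltac:(lia) ltac:(lia).
have [l [? ?]] := IH (i + 2 ^ t) j ltac:(lia) ltac:(lia).
move=> four; have [m1|m2] : gp (f i) (f (i + 2 ^ t)) z <= gp (f i) (f j) z + h \/
  gp (f (i + 2 ^ t)) (f j) z <= gp (f i) (f j) z + h by lia.
- by exists k; split; nia.
- by exists l; split; nia.
Qed.

Lemma least_Z (P : Z -> Prop) D : 0 <= D -> P D ->
  exists E, [/\ 0 <= E, P E & E = 0 \/ ~ P (E - 1)].
Proof.
move: D; apply: natlike_ind => [|D D0 IH] PD; first by exists 0; split=> //; left.
have [/IH//|nP] := pselect (P D).
exists (Z.succ D); split=> //; first lia.
by right; rewrite (_ : Z.succ D - 1 = D) //; lia.
Qed.

(* If D is the largest distance from the geodesic to the path, the part of the path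
   going around z stays at distance D of z, so its length is exponential in D, while
   it joins points at distance at most 6 D. *)
Lemma morse_near_path L C : 0 <= L -> 0 <= C -> exists D, 0 <= D /\
  forall f n, quasi_geodesic L C f n ->
  forall z, gp (f 0) (f n) z <= 0 -> exists i, 0 <= i <= n /\ d z (f i) <= D.
Proof.
move=> L0 C0; have h0 := hyp_gt0 hd.
(* The linear function is L (6 D + C) with D expressed through the number t of halvings chosen
   below. *)
have [t0 [t01 big]] := linear_le_pow2 (3 * h * L) (L * (9 * h + 6 * L + 3 + C)).
exists (h * (t0 + 3) + L + 1); split; first nia.
move=> f n [n0 step qg].
pose P D := forall z, gp (f 0) (f n) z <= 0 -> exists i, 0 <= i <= n /\ d z (f i) <= D.
have [|D [D0 PD DP]] := least_Z P (d (f 0) (f n)) (dist_ge0 hd _ _).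
  move=> z zP; exists 0; split; first lia.
  move: zP; rewrite /gromov (distC hd z (f 0)); have := dist_ge0 hd (f n) z; lia.
have [small|large] := Z.le_gt_cases D (h * (t0 + 3) + L + 1).
  by move=> z /PD[i [ni zi]]; exists i; split=> //; lia.
exfalso; case: DP => [|nP]; first by nia.
apply: nP => z zP; apply: contrapT => no.
have far i : 0 <= i <= n -> D <= d z (f i).
  move=> ni; have [zi|] := Z.le_gt_cases (d z (f i)) (D - 1); last lia.
  by case: no; exists i.
(* A point of the path near the geodesic, far enough from z on a given side. *)
have side e : e = 0 \/ e = n -> exists y i, [/\ 0 <= i <= n, d y (f i) <= D,
    d (f e) y + d y z = d (f e) z, d y z <= 2 * D & 2 * D <= gp y (f i) z].
  move=> eE; have ne : 0 <= e <= n by lia.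
  have [close|away] := Z.le_gt_cases (d (f e) z) (2 * D).
    exists (f e), e; rewrite /gromov (distxx hd); have := far e ne; rewrite (distC hd z).
    by split=> //; lia.
  have [y [y1 y2]] := dist_between hd z (f e) (2 * D) ltac:(rewrite (distC hd z); lia).
  have yz : d (f e) y + d y z = d (f e) z.
    by rewrite (distC hd (f e) y) (distC hd y z) (distC hd (f e) z); lia.
  have [|i [ni yi]] := PD y.
    move: zP; rewrite /gromov; case: eE yz => ->.
      have := dist_triangle hd y z (f n); rewrite (distC hd y (f n)) (distC hd z (f n)); lia.
    have := dist_triangle hd (f 0) z y; rewrite (distC hd z y); lia.
  exists y, i; split=> //; first by rewrite (distC hd y z); lia.
  by have := gp_near hd y (f i) z; rewrite (distC hd y z); lia.
have [y [i [ni yi fy yz gy]]] := side 0 (or_introl erefl).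
have [y' [j [nj y'j fy' y'z gy']]] := side n (or_intror erefl).
have g0 : gp y y' z <= 0.
  move: zP; rewrite /gromov.
  have := dist_triangle hd (f 0) y (f n); have := dist_triangle hd y y' (f n).
  rewrite (distC hd y' (f n)); lia.
have Dh : 2 * h + L < D by nia.
have g1 : gp (f i) y' z <= h by have := gp_move hd _ (f i) _ _ _ g0; lia.
have g2 : gp (f i) (f j) z <= 2 * h by have := gp_move_r hd _ _ (f j) _ _ g1; lia.
have dij : d (f i) (f j) <= 6 * D.
  have := dist_triangle hd (f i) y (f j); have := dist_triangle hd y z (f j).
  have := dist_triangle hd z y' (f j).
  by rewrite (distC hd (f i) y) (distC hd z y'); lia.
(* Chosen so that 2h + h t stays below 2 D - L, a lower bound for the product of consecutive path
   points at distance at least D from z. *)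
pose t := (2 * D - 2 * h - 2 * L - 1) / h.
have tE : h * t <= 2 * D - 2 * h - 2 * L - 1 < h * (t + 1).
  have := Z.div_mod (2 * D - 2 * h - 2 * L - 1) h.
  have := Z.mod_pos_bound (2 * D - 2 * h - 2 * L - 1) h; rewrite /t; lia.
have tt0 : t0 <= t by nia.
have long : L * (6 * D + C) <= 2 ^ t.
  apply: Z.le_trans (big t tt0).
  have : 6 * D <= 3 * h * t + (9 * h + 6 * L + 3) by lia.
  nia.
(* Stated for ordered indices, since either of i and j may come first on the path. *)
have contra k l : 0 <= k <= l -> l <= n -> gp (f k) (f l) z <= 2 * h ->
    d (f k) (f l) <= 6 * D -> False.
  move=> kl ln gkl dkl; have [e|lt] : k = l \/ k < l by lia.
    by move: gkl; rewrite e /gromov (distxx hd) (distC hd (f l)); have := far l; lia.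
  have lk := qg k l kl ln.
  have [|r [rl gr]] := chain_product f z t ltac:(lia) k l lt.
    apply: Z.le_trans long; apply: Z.le_trans lk _.
    by apply: Z.mul_le_mono_nonneg_l; lia.
  have st := step r ltac:(lia).
  have := dist_triangle hd z (f (r + 1)) (f r).
  have {}gr : gp (f r) (f (r + 1)) z <= 2 * h + h * t by lia.
  move: gr; rewrite /gromov; have := far r ltac:(lia).
  rewrite (distC hd z (f r)) (distC hd z (f (r + 1))) (distC hd (f (r + 1)) (f r)); lia.
have [ij|ji] := Z.le_ge_cases i j; first by apply: (contra i j) => //; lia.
by apply: (contra j i); rewrite ?(gpC hd (f j)) ?(distC hd (f j)) //; lia.
Qed.

(** A connectedness argument: along the geodesic, nearness to path points of index at most i gives
    way to nearness to points of index at least i. At the switch two such path points are close, so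
    their indices differ by at most [W] and f i lies between them. *)
Lemma morse_near_geodesic L C : 0 <= L -> 0 <= C -> exists D, 0 <= D /\
  forall f n, quasi_geodesic L C f n ->
  forall i, 0 <= i <= n -> exists z, gp (f 0) (f n) z <= 0 /\ d z (f i) <= D.
Proof.
move=> L0 C0; have h0 := hyp_gt0 hd.
have [D [D0 near]] := morse_near_path L C L0 C0.
pose W := L * (2 * D + 1 + h + C).
exists (D + L * W); split; first by rewrite /W; nia.
move=> f n qg i ni; have [n0 step ql] := qg.
pose N := d (f 0) (f n); have N0 : 0 <= N by apply: (dist_ge0 hd).
(* The points are picked separately for each t, possibly on different geodesics; hence the step
   bound 1 + h. Outside the range f 0 is a default. *)
have zex t : exists z, 0 <= t <= N -> d (f 0) z = t /\ d z (f n) = N - t.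
  have [tN|?] := pselect (0 <= t <= N); last by exists (f 0).
  by have [z ?] := dist_between hd (f 0) (f n) t tN; exists z.
have [z zP] := choice zex.
have geo t : 0 <= t <= N -> gp (f 0) (f n) (z t) <= 0.
  by move=> tN; have := zP t tN; rewrite /gromov (distC hd (f n) (z t)) -/N; lia.
have zstep t : 0 <= t < N -> d (z t) (z (t + 1)) <= 1 + h.
  move=> tN; have := fellow_points hd (f 0) (f n) (z t) (z (t + 1)).
  have := geo t ltac:(lia); have := geo (t + 1) ltac:(lia).
  have := zP t ltac:(lia); have := zP (t + 1) ltac:(lia); lia.
have z0 : z 0 = f 0 by apply/esym/(dist_eq0 hd); have := zP 0 ltac:(lia); lia.
have zN : z N = f n by apply: (dist_eq0 hd); have := zP N ltac:(lia); lia.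
have len j k : 0 <= j <= k -> k <= n -> d (f j) (f k) <= L * (k - j).
  move=> jk kn; have -> : k = (k - j) + j by lia.
  move: (k - j) (ltac:(lia) : 0 <= k - j) (ltac:(lia) : (k - j) + j <= n).
  apply: natlike_ind => [|m m0 IH] mn; first by rewrite (distxx hd); lia.
  have := dist_triangle hd (f j) (f (m + j)) (f (m + j + 1)).
  have := step (m + j) ltac:(lia).
  have := IH ltac:(lia); rewrite (_ : Z.succ m + j = m + j + 1); lia.
pose Q t := exists2 k, 0 <= k <= i & d (z t) (f k) <= D.
suff [t [k [k' [tN ki ik' kd kd']]]] : exists t k k', [/\ 0 <= t <= N, 0 <= k <= i,
    i <= k' <= n, d (z t) (f k) <= D & d (z t) (f k') <= D + 1 + h].
  exists (z t); split; first exact: geo.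
  have kk' : k' - k <= W.
    have := ql k k' ltac:(lia) ltac:(lia).
    have := dist_triangle hd (f k) (z t) (f k').
    by rewrite (distC hd (f k) (z t)) /W; nia.
  have := len k i ltac:(lia) ltac:(lia); have := dist_triangle hd (z t) (f k) (f i).
  nia.
have [t0 tN nQ] : exists2 t, 0 <= t <= N & Q t /\ (t = N \/ ~ Q (t + 1)).
  apply: contrapT => no.
  suff all t : 0 <= t -> t <= N -> Q t by case: no; exists N; [lia|split; [apply: all; lia|left]].
  move: t; apply: natlike_ind => [|t t0 IH] tN.
    by exists 0; [lia|rewrite z0 (distxx hd)].
  apply: contrapT => nq; case: no; exists t; first lia.
  by split; [apply: IH; lia|right].
case: nQ => [[k ki kd]] nQ; have [tE|tlt] : t0 = N \/ t0 < N by lia.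
  exists t0, k, n; split=> //; first lia; rewrite tE zN (distxx hd); lia.
case: nQ => [|nQ]; first lia.
have [k' [kn kd']] := near f n qg (z (t0 + 1)) (geo (t0 + 1) ltac:(lia)).
have ik' : i <= k'.
  have [//|k'i] := Z.le_gt_cases i k'; exfalso; apply: nQ; exists k' => //; lia.
exists t0, k, k'; split=> //; try lia.
have := dist_triangle hd (z t0) (z (t0 + 1)) (f k'); have := zstep t0 ltac:(lia); lia.
Qed.

Lemma morse_fellow_travel L C : 0 <= L -> 0 <= C -> exists D, 0 <= D /\
  forall f n f' n', quasi_geodesic L C f n -> quasi_geodesic L C f' n' ->
  f 0 = f' 0 -> f n = f' n' ->
  forall i, 0 <= i <= n -> exists j, 0 <= j <= n' /\ d (f i) (f' j) <= D.
Proof.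
move=> L0 C0; have [D [D0 near]] := morse_near_path L C L0 C0.
have [E [E0 near']] := morse_near_geodesic L C L0 C0.
exists (D + E); split=> [|f n f' n' qg qg' e0 en i ni]; first lia.
have [z [zg zi]] := near' f n qg i ni.
rewrite e0 en in zg; have [j [nj zj]] := near f' n' qg' z zg.
exists j; split=> //; have := dist_triangle hd (f i) z (f' j).
rewrite (distC hd (f i) z); lia.
Qed.

End Morse.

(** * The word metric of a Cayley graph *)

Section PathsInGraphs.
Variables (V : eqType) (e : rel V).
Hypothesis e_sym : symmetric e.
Implicit Types (x y z : V) (p q : seq V).

Lemma path_from_to_cat x y z p q :
  path_from_to e x y p -> path_from_to e y z q -> path_from_to e x z (p ++ q).
Proof. by move=> [ep <-] [eq <-]; split; rewrite ?last_cat // cat_path ep. Qed.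

Lemma path_from_to_rev x y p :
  path_from_to e x y p -> path_from_to e y x (rev (belast x p)).
Proof.
move=> [ep <-]; split.
  by rewrite rev_path; rewrite (eq_path (e' := e)) // => a b; rewrite e_sym.
by case: p {ep} => //= z p; rewrite rev_cons last_rcons.
Qed.

Lemma path_from_to_split x y p v : path_from_to e x y p -> v \in x :: p ->
  exists p1 p2, [/\ p = p1 ++ p2, path_from_to e x v p1 & path_from_to e v y p2].
Proof.
move=> [ep <-] vp; case/splitPl: vp ep => p1 p2 vE.
rewrite cat_path => /andP[e1 e2].
by exists p1, p2; rewrite /path_from_to -vE last_cat.
Qed.

Lemma path_from_to_nth x y p i : path_from_to e x y p -> (i <= size p)%N ->
  path_from_to e x (nth x (x :: p) i) (take i p) /\
  path_from_to e (nth x (x :: p) i) y (drop i p).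
Proof.
move=> [ep <-] ip; rewrite -{1}(cat_take_drop i p) cat_path in ep.
have nE : nth x (x :: p) i = last x (take i p).
  rewrite (last_nth x) size_takel //; case: i ip {ep} => //= i ip.
  by rewrite nth_take.
case/andP: ep => e1 e2; rewrite nE /path_from_to; split=> //; split=> //.
by rewrite -{3}(cat_take_drop i p) last_cat.
Qed.

End PathsInGraphs.

(** * The word metric and its four-point inequality *)

Section CayleyMetric.
Context {G : groupType}.
Variable S : seq G.
Hypothesis genS : generating S.
Implicit Types (x y z g : G) (p q : seq G).
Local Notation e := (cayley S).

Lemma cayley_sym : symmetric e.
Proof. by move=> x y; rewrite /cayley orbC. Qed.

Lemma cayleyM g x y : e (g * x) (g * y) = e x y.
Proof. by rewrite /cayley !invgM -!mulgA !mulKg. Qed.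

Lemma path_from_toM g x y p :
  path_from_to e x y p -> path_from_to e (g * x) (g * y) [seq g * z | z <- p].
Proof.
move=> [ep <-]; split; last by rewrite last_map.
by rewrite path_map; rewrite (eq_path (e' := e)) // => a b /=; rewrite cayleyM.
Qed.

Lemma cayley_connected x y : exists p, path_from_to e x y p.
Proof.
have : [set g | forall x, exists p, path_from_to e x (x * g) p] (x^-1 * y).
  have : generated [set` S] (x^-1 * y) by rewrite genS.
  apply: generated_sub; last first.
    move=> s sS z; exists [:: z * s]; split=> //=.
    by rewrite /cayley mulKg sS.
  split=> [z|a b ca cb z|a ca z].
  - by exists [::]; rewrite mulg1.
  - have [p pP] := ca z; have [q qP] := cb (z * a).
    by exists (p ++ q); apply: path_from_to_cat pP _; rewrite mulgA.
  - have [p] := ca (z * a^-1); rewrite mulgVK => pP.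
    by exists (rev (belast (z * a^-1) p)); apply: path_from_to_rev pP; exact: cayley_sym.
by move=> /(_ x); rewrite mulVKg.
Qed.

Definition reachable_in x y (n : nat) : bool :=
  `[< exists p, path_from_to e x y p /\ size p = n >].

Lemma reachable x y : exists n, reachable_in x y n.
Proof. by have [p pP] := cayley_connected x y; exists (size p); apply/asboolP; exists p. Qed.

Definition cdist x y : nat := ex_minn (reachable x y).

Lemma cdist_geodesic x y : exists p, geodesic e x y p /\ size p = cdist x y.
Proof.
rewrite /cdist; case: ex_minnP => n /asboolP[p [pP pn]] min; exists p; split=> //.
by split=> // q qP; rewrite pn; apply: min; apply/asboolP; exists q.
Qed.

Lemma cdist_le x y p : path_from_to e x y p -> (cdist x y <= size p)%N.
Proof.
by move=> pP; rewrite /cdist; case: ex_minnP => n _; apply; apply/asboolP; exists p.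
Qed.

Lemma geodesic_size x y p : geodesic e x y p -> size p = cdist x y.
Proof.
move=> [pP min]; have [q [[qP _] qs]] := cdist_geodesic x y.
by apply/eqP; rewrite eqn_leq cdist_le // -qs min.
Qed.

Lemma cdistxx x : cdist x x = 0%N.
Proof. by apply/eqP; rewrite -leqn0; apply: (cdist_le x x [::]). Qed.

Lemma cdist_eq0 x y : cdist x y = 0%N -> x = y.
Proof. by have [p [[[_ <-] _] <-]] := cdist_geodesic x y => /size0nil ->. Qed.

Lemma cdistC x y : cdist x y = cdist y x.
Proof.
suff le a b : (cdist a b <= cdist b a)%N by apply/eqP; rewrite eqn_leq !le.
have [p [[pP _] <-]] := cdist_geodesic b a.
by have := cdist_le _ _ _ (path_from_to_rev _ _ cayley_sym _ _ _ pP); rewrite size_rev size_belast.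
Qed.

Lemma cdist_triangle x y z : (cdist x z <= cdist x y + cdist y z)%N.
Proof.
have [p [[pP _] <-]] := cdist_geodesic x y; have [q [[qP _] <-]] := cdist_geodesic y z.
by rewrite -size_cat; apply/cdist_le/path_from_to_cat/qP.
Qed.

Lemma cdistM g x y : cdist (g * x) (g * y) = cdist x y.
Proof.
have le f a b : (cdist (f * a) (f * b) <= cdist a b)%N.
  have [p [[pP _] <-]] := cdist_geodesic a b.
  by have := cdist_le _ _ _ (path_from_toM f _ _ _ pP); rewrite size_map.
by apply/eqP; rewrite eqn_leq le /=; have := le g^-1 (g * x) (g * y); rewrite !mulKg.
Qed.

Lemma cdist_split x y p v : geodesic e x y p -> v \in x :: p ->
  (cdist x v + cdist v y = cdist x y)%N.
Proof.
move=> gp vp; have [pP _] := gp.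
have [p1 [p2 [pE p1P p2P]]] := path_from_to_split _ _ _ _ _ _ pP vp.
apply/eqP; rewrite eqn_leq cdist_triangle andbT -(geodesic_size _ _ _ gp) pE size_cat.
by rewrite leq_add // cdist_le.
Qed.

Lemma cdist_between x y i : (i <= cdist x y)%N ->
  exists z, cdist x z = i /\ cdist z y = (cdist x y - i)%N.
Proof.
have [p [gp ps]] := cdist_geodesic x y; rewrite -{1}ps => ip; have [pP _] := gp.
set z := nth x (x :: p) i; have [p1 p2] := path_from_to_nth _ _ _ _ _ _ pP ip.
have := cdist_split _ _ _ z gp (mem_nth _ (ip : (i < size (x :: p))%N)).
have := cdist_le _ _ _ p1; have := cdist_le _ _ _ p2; rewrite -/z size_drop size_takel // ps.
rewrite -minusE -plusE => /leP l2 /leP l1 sum; exists z.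
by move/leP: ip; rewrite ps; lia.
Qed.

Lemma finite_cballs (r : nat) : exists s : seq G, forall g, (cdist 1 g <= r)%N -> g \in s.
Proof.
elim: r => [|r [s sP]].
  by exists [:: 1] => g; rewrite leqn0 => /eqP/cdist_eq0 <-; rewrite mem_head.
exists (s ++ [seq g * t | g <- s, t <- S ++ [seq t^-1 | t <- S]]) => g.
rewrite leq_eqVlt ltnS mem_cat => /orP[/eqP gr|/sP ->//].
have [z [z1 z2]] := cdist_between 1 g r (ltac:(by rewrite gr) : (r <= cdist 1 g)%N).
apply/orP; right; apply/allpairsP; exists (z, z^-1 * g); split=> /=; last by rewrite mulVKg.
  by apply: sP; rewrite z1.
have [p [[[ep pl] _] ps]] := cdist_geodesic z g.
move: ps; rewrite z2 gr subSnn; case: p ep pl => [|g' [|]] //= + <-.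
rewrite andbT mem_cat /cayley => /orP[->//|gzS] _; apply/orP; right.
by apply/mapP; exists (g'^-1 * z) => //=; rewrite invgM invgK.
Qed.

Section Slim.
Variable delta : nat.
Hypothesis slim : slim_triangles e delta.

(** The side p runs from a point of r to a point of q. Where nearness to r is first lost, the vertex
    is near q and its predecessor near r, one edge away. *)
Lemma slim_center x y z p q r :
  geodesic e x y p -> geodesic e y z q -> geodesic e z x r ->
  exists u v w, [/\ u \in x :: p, v \in y :: q, w \in z :: r,
    (cdist u v <= delta.+1)%N & (cdist u w <= delta.+1)%N].
Proof.
move=> gp gq gr; have [[ep pl] _] := gp.
pose u i := nth x (x :: p) i.
have up i : (i <= size p)%N -> u i \in x :: p by move=> ip; apply: mem_nth.
have nearP i : (i <= size p)%N -> (exists2 v, v \in y :: q & (cdist (u i) v <= delta)%N) \/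
    (exists2 w, w \in z :: r & (cdist (u i) w <= delta)%N).
  move=> /up ui; have [v vqr [s sP sd]] := slim _ _ _ _ _ _ gp gq gr _ ui.
  have d1 := leq_trans (cdist_le _ _ _ sP) sd.
  by case: vqr => vq; [left|right]; exists v.
have ustep i : (i < size p)%N -> (cdist (u i) (u i.+1) <= 1)%N.
  move=> ip; apply: (cdist_le _ _ [:: u i.+1]); split=> //=; rewrite andbT.
  by have /(pathP x) := ep; apply.
have yE : u (size p) = y by rewrite /u nth_last -pl; case: (p).
have [all|//] : (exists2 w, w \in z :: r & (cdist (u (size p)) w <= delta)%N) \/
    exists u v w, [/\ u \in x :: p, v \in y :: q, w \in z :: r,
      (cdist u v <= delta.+1)%N & (cdist u w <= delta.+1)%N].
  move: (leqnn (size p)); move: {-2}(size p) => n; elim: n => [|n IH] np.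
    left; exists x; last by rewrite cdistxx.
    by have [[_ <-] _] := gr; apply: mem_last.
  have [[w wr uw]|] := IH (ltnW np); last by right.
  have [[v vq uv]|] := nearP n.+1 np; last by left.
  right; exists (u n.+1), v, w; split=> //; [exact: up|exact: ltnW|].
  rewrite (leq_trans (cdist_triangle _ (u n) _)) // (cdistC (u n.+1)) -(add1n delta).
  by rewrite leq_add // ustep.
rewrite yE in all; have [w wr dw] := all.
exists y, y, w; split=> //;
  [by rewrite -yE; apply: up|exact: mem_head|by rewrite cdistxx|exact: ltnW].
Qed.

(** The diagonal from x to z contains a centre u of the triangle x z w, and u is also within delta
    of a side at y. Passing through u costs 4 (delta + 1) towards w and 2 delta towards y, in all 6
    delta + 4. *)
Lemma cayley_hyperbolic : exists h,
  hyperbolic_metric (fun x y => Z.of_nat (cdist x y)) h.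
Proof.
pose dl := Z.of_nat delta; exists (6 * dl + 4)%Z.
split=> [x y|x y|x|x y|x y z|g x y|x y i ixy|r|x y z w|].
- lia.
- by move=> e0; apply: cdist_eq0; lia.
- by rewrite cdistxx.
- by rewrite cdistC.
- by have /leP := cdist_triangle x y z; rewrite -plusE; lia.
- by rewrite cdistM.
- have [|z [z1 z2]] := cdist_between x y (Z.to_nat i); first by apply/leP; lia.
  by exists z; rewrite z1 z2 -minusE; lia.
- have [s sP] := finite_cballs (Z.to_nat r); exists s => g gr; apply: sP; apply/leP; lia.
- have tri a b c : (Z.of_nat (cdist a c) <= Z.of_nat (cdist a b) + Z.of_nat (cdist b c))%Z.
    by have /leP := cdist_triangle a b c; rewrite -plusE; lia.
  have onseg a b p v : geodesic e a b p -> v \in a :: p ->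
      (Z.of_nat (cdist a v) + Z.of_nat (cdist v b) = Z.of_nat (cdist a b))%Z.
    by move=> gp vp; have := cdist_split _ _ _ _ gp vp; rewrite -plusE; lia.
  have [p [gp _]] := cdist_geodesic x z; have [q [gq _]] := cdist_geodesic z w.
  have [r [gr _]] := cdist_geodesic w x.
  have [u [v [t [up vq tr /leP uv /leP ut]]]] := slim_center _ _ _ _ _ _ gp gq gr.
  have e1 := onseg _ _ _ _ gp up; have e2 := onseg _ _ _ _ gq vq.
  have e3 := onseg _ _ _ _ gr tr.
  have [a [ga _]] := cdist_geodesic z y; have [b [gb _]] := cdist_geodesic y x.
  have [s sab [l lP ls]] := slim _ _ _ _ _ _ gp ga gb u up.
  have /leP us := leq_trans (cdist_le _ _ _ lP) ls.
  have t1 := tri x u w; have t2 := tri z u w.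
  have wu : (2 * Z.of_nat (cdist u w) + Z.of_nat (cdist x z) <=
      Z.of_nat (cdist x w) + Z.of_nat (cdist z w) + 4 * (dl + 1))%Z.
    have := tri u t w; have := tri x t u; have := tri u v w; have := tri z v u.
    have := cdistC t u; have := cdistC v u; have := cdistC t w; have := cdistC x w.
    have := cdistC u z; have := cdistC x t; lia.
  have t3 := tri x s w; have t4 := tri y s w; have t5 := tri z s w; have t6 := tri s u w.
  have s1 := cdistC s u; have s2 := cdistC z y; have s3 := cdistC s y.
  have s4 := cdistC y x; have s5 := cdistC s x.
  by case: sab => sab; [have e4 := onseg _ _ _ _ ga sab|have e4 := onseg _ _ _ _ gb sab]; lia.
- lia.
Qed.
End Slim.
End CayleyMetric.

(** * Comparison of word metrics *)

Section ChangeOfGenerators.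
Context {G : groupType}.
Implicit Types (x y : G) (S T p : seq G).

Lemma cayley_edge_bound S T (genT : generating T) : exists l : nat,
  forall x y, cayley S x y -> (cdist T genT x y <= l)%N.
Proof.
exists (\max_(s <- S) cdist T genT 1 s) => x y.
have bound z t : z^-1 * t \in S -> (cdist T genT z t <= \max_(s <- S) cdist T genT 1 s)%N.
  move=> sS; rewrite -(cdistM T genT z^-1) mulVg.
  exact: (leq_bigmax_seq (F := fun s => cdist T genT 1 s) _ sS).
by case/orP => /bound //; rewrite cdistC.
Qed.

Lemma cdist_path_bound S T (genT : generating T) (l : nat) :
  (forall x y, cayley S x y -> (cdist T genT x y <= l)%N) ->
  forall x p, path (cayley S) x p -> (cdist T genT x (last x p) <= l * size p)%N.
Proof.
move=> edge x p; elim: p x => [|y p IH] x /=; first by rewrite cdistxx muln0.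
case/andP=> /edge xy /IH yp; rewrite mulnS.
by rewrite (leq_trans (cdist_triangle T genT x y _)) // leq_add.
Qed.

Lemma cdist_change S T (genS : generating S) (genT : generating T) : exists l : nat,
  forall x y, (cdist T genT x y <= l * cdist S genS x y)%N.
Proof.
have [l edge] := cayley_edge_bound S T genT; exists l => x y.
have [p [[[ep <-] _] <-]] := cdist_geodesic S genS x y.
exact: cdist_path_bound edge x p ep.
Qed.

End ChangeOfGenerators.

(** * Quasi-convexity and freeness from linear growth *)

Section QuasiConvexity.
Context {G : groupType}.
Variable S0 : seq G.
Hypothesis gen0 : generating S0.
Local Notation d x y := (Z.of_nat (cdist S0 gen0 x y)).
Local Notation d0 := (fun x y : G => d x y).
Variable h : Z.
Hypothesis hd : hyperbolic_metric d0 h.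
Local Open Scope Z_scope.
Variables (A B o : G) (L : Z).
Hypothesis L1 : 1 <= L.
Hypothesis growth : forall w, reduced w -> word_on A B w ->
  Z.of_nat (size w) <= L * d o (word_val w * o)%g.

(** Subwords of a reduced word are reduced, so the growth bound applies between any two prefixes.
    The additive constant pays for moving the base point from [o] to 1. *)
Lemma reduced_word_quasi_geodesic L' (x : G) w :
  L <= L' -> d 1%g A <= L' -> d 1%g B <= L' ->
  reduced w -> word_on A B w ->
  quasi_geodesic (d := d0) L' (2 * d 1%g o) (fun i => x * word_val (take (Z.to_nat i) w))%g
    (Z.of_nat (size w)).
Proof.
move=> LL' dA dB red on; split=> [|i iw|i j ij jw]; first lia.
  have iw' : (Z.to_nat i < size w)%N by apply/ltP; lia.
  have -> : Z.to_nat (i + 1) = (Z.to_nat i).+1 by lia.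
  rewrite (distM hd) (take_nth (1%g, true)) // -cats1 word_val_cat word_val_cons word_val_nil.
  rewrite mulg1 -{1}(mulg1 (word_val _)) (distM hd).
  set l := nth _ _ _; have : l.1 = A \/ l.1 = B by apply: on; apply: mem_nth.
  have inv (y : G) : d 1%g y^-1%g = d 1%g y.
    by rewrite -(distM hd y 1%g y^-1%g) mulg1 mulgV (distC hd).
  by rewrite /letter_val; case: (l.2); case=> ->; rewrite ?inv.
rewrite (distM hd).
set v := drop (Z.to_nat i) (take (Z.to_nat j) w).
have szv : Z.of_nat (size v) = j - i.
  rewrite /v size_drop size_takel; last by apply/leP; lia.
  by rewrite -minusE; lia.
have -> : word_val (take (Z.to_nat j) w) = (word_val (take (Z.to_nat i) w) * word_val v)%g.
  rewrite -word_val_cat; congr word_val; rewrite /v.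
  rewrite -{1}(cat_take_drop (Z.to_nat i) (take (Z.to_nat j) w)); congr (_ ++ _).
  by rewrite take_takel //; apply/leP; lia.
rewrite -{1}(mulg1 (word_val _)) (distM hd) -szv.
have redv : reduced v by apply/reduced_drop/reduced_take.
have onv : word_on A B v by move=> l /mem_drop/mem_take; apply: on.
apply: Z.le_trans (growth v redv onv) _.
have t1 := dist_triangle hd o 1%g (word_val v * o)%g.
have t2 := dist_triangle hd 1%g (word_val v) (word_val v * o)%g.
have e1 : d (word_val v) (word_val v * o)%g = d 1%g o.
  by rewrite -{1}(mulg1 (word_val v)) (distM hd).
rewrite e1 in t2; rewrite (distC hd o 1%g) in t1.
have t3 : d o (word_val v * o)%g <= d 1%g (word_val v) + 2 * d 1%g o by lia.
by apply: Z.mul_le_mono_nonneg => //; lia.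
Qed.

(** Hyperbolicity is used only in the metric of [S0]: a geodesic for S is a quasi-geodesic there,
    and it fellow-travels with the prefixes of a reduced word, all of which lie in a coset of the
    subgroup that is the subgroup itself. *)
Lemma quasi_convex_of_growth : quasi_convex (generated [set A; B]).
Proof.
move=> S genS.
have [l1 l1P] := cayley_edge_bound S S0 gen0.
have [l2 l2P] := cdist_change S0 S gen0 genS.
pose L' := L + Z.of_nat l1 + Z.of_nat l2 + d 1%g A + d 1%g B.
have C0 : 0 <= 2 * d 1%g o by lia.
have L'0 : 0 <= L' by rewrite /L'; lia.
have [D [D0 fellow]] := morse_fellow_travel hd L' (2 * d 1%g o) L'0 C0.
(* D is measured with [S0]; the factor l2 converts it to S. *)
exists (l2 * Z.to_nat D)%N => x y p Hx Hy gp v vp.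
have sH := generated_subgroup [set A; B].
have Hxy : generated [set A; B] (x^-1 * y)%g.
  by case: (sH) => _ mulH invH; apply: mulH => //; apply: invH.
have [w [on red wE]] := generated_word A B _ Hxy.
have qw := reduced_word_quasi_geodesic L' x w ltac:(rewrite /L'; lia) ltac:(rewrite /L'; lia)
  ltac:(rewrite /L'; lia) red on.
have [pP _] := gp.
have qp : quasi_geodesic (d := d0) L' (2 * d 1%g o)
    (fun i => nth x (x :: p) (Z.to_nat i)) (Z.of_nat (size p)).
  split=> [|i ip|i j ij jp]; first lia.
    have -> : Z.to_nat (i + 1) = (Z.to_nat i).+1 by lia.
    have ip' : (Z.to_nat i < size p)%N by apply/ltP; lia.
    have [ep _] := pP; have /leP := l1P _ _ (pathP x ep _ ip').
    by rewrite /L' /=; lia.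
  have ip' : (Z.to_nat i <= size p)%N by apply/leP; lia.
  have jp' : (Z.to_nat j <= size p)%N by apply/leP; lia.
  have [p1 _] := path_from_to_nth _ _ _ _ _ _ pP ip'.
  have [_ p2] := path_from_to_nth _ _ _ _ _ _ pP jp'.
  move: p1 p2; set u := nth _ _ _; set u' := nth _ _ _ => p1 p2.
  have /leP := cdist_le S genS _ _ _ p1; rewrite size_takel // => q1.
  have /leP := cdist_le S genS _ _ _ p2; rewrite size_drop -minusE => q2.
  have /leP := cdist_triangle S genS x u y; rewrite -plusE => q3.
  have /leP := cdist_triangle S genS u u' y; rewrite -plusE => q4.
  have /leP := l2P u u'; rewrite -multE => q5.
  have szp := geodesic_size S genS _ _ _ gp.
  have q6 : j - i <= Z.of_nat l2 * d u u' by lia.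
  apply: Z.le_trans q6 _; apply: Z.mul_le_mono_nonneg; rewrite /L'; lia.
have ip : (index v (x :: p) <= size p)%N by rewrite -ltnS -[(size p).+1]/(size (x :: p)) index_mem.
have [|||j [jw dj]] := fellow _ _ _ _ qp qw _ _ (Z.of_nat (index v (x :: p))).
- by rewrite /= take0 word_val_nil mulg1.
- have [_ pl] := pP; rewrite !Nat2Z.id take_size wE mulVKg -pl.
  exact: (nth_last x (x :: p)).
- by move/leP: ip; lia.
rewrite Nat2Z.id nth_index // in dj.
exists (x * word_val (take (Z.to_nat j) w))%g.
  case: (sH) => _ mulH _; apply: mulH => //; apply: word_val_generated.
  by move=> l /mem_take; apply: on.
have [q [[qP _] qs]] := cdist_geodesic S genS v (x * word_val (take (Z.to_nat j) w))%g.
exists q => //; rewrite qs; apply: leq_trans (l2P _ _) _; rewrite leq_mul2l; apply/orP; right.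
by apply/leP; lia.
Qed.

(** A word of value 1 does not move [o], so the growth bound leaves it no letters. *)
Lemma free_of_growth : free_subgroup (generated [set A; B]).
Proof.
exists [set A; B]; split=> // w on red w1.
have := growth w red (fun l lw => on l lw); rewrite w1 mul1g cdistxx.
by case: w {on red w1} => //= l w; lia.
Qed.
End QuasiConvexity.

Lemma infinite_order_expg (G : groupType) (a : G) n :
  infinite_order a -> (0 < n)%N -> infinite_order (a ^+ n).
Proof. by move=> oa n0 m m0; rewrite -expgnA; apply: oa; rewrite muln_gt0 n0. Qed.

Theorem mainTheorem4 (G : groupType) (hG : word_hyperbolic G) :
  exists M : nat, forall a b : G, infinite_order a -> infinite_order b ->
    elementary (generated [set a; b]) \/
    forall n m : nat, (M <= n)%N -> (M <= m)%N ->
      free_subgroup (generated [set a ^+ n; b ^+ m]) /\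
      quasi_convex (generated [set a ^+ n; b ^+ m]).
Proof.
have [S genS [delta slim]] := hG.
have [h hd] := cayley_hyperbolic S genS delta slim.
have [M MP] := pingpong_large_powers hd.
have free_qc (A B o : G) R : infinite_order A -> infinite_order B ->
    pingpong (d := fun x y => Z.of_nat (cdist S genS x y)) (h := h) A B o R ->
    free_subgroup (generated [set A; B]) /\ quasi_convex (generated [set A; B]).
  move=> oA oB pp; have [L [L1 growth]] := pingpong_reduced_growth hd A B o R oA oB pp.
  split; first exact: (free_of_growth S genS A B o L growth).
  exact: (quasi_convex_of_growth S genS h hd A B o L L1 growth).
(* The successor makes n and m positive, so that a^n and b^m have infinite order. *)
exists M.+1 => a b oa ob.
have [[i [j [i1 [j1 cij]]]]|nc] :=
    pselect (exists i j, (1 <= i)%Z /\ (1 <= j)%Z /\ commute (zpow a i) (zpow b j)).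
  by left; apply: (commuting_powers_elementary hd a b i j).
right=> n m Mn Mm.
have [oan obm] : infinite_order (a ^+ n) /\ infinite_order (b ^+ m).
  by split; apply: infinite_order_expg => //; apply: leq_trans (ltn0Sn M) _.
have [i j i1 j1 cij|pp|pp] := MP a b oa ob.
- by apply: nc; exists i, j.
- by have [o [R]] := pp n m (ltnW Mn) (ltnW Mm); apply: free_qc.
- by have [o [R]] := pp n m (ltnW Mn) (ltnW Mm); rewrite setUC; apply: free_qc.
Qed.
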